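(* Let $G$ be a Hausdorff ample groupoid and $R$ a commutative ring with $1$. (1) If all the isotropy groups of $G$ are abelian, then $IJ=JI$ for all ideals $I,J\in\mathcal{L}(A_R(G))$. (2) If $RG_u^u$ is an arithmetical ring for all $u\in G^{(0)}$, then $A_R(G)$ is an arithmetical ring.
   Context: For a groupoid $G$ with unit space $G^{(0)}$, $\boldsymbol{s}(x)=x^{-1}x$, $\boldsymbol{r}(x)=xx^{-1}$, $G_u=\boldsymbol{s}^{-1}(u)$, and $G_u^u=\{x\in G\mid \boldsymbol{s}(x)=\boldsymbol{r}(x)=u\}$ is the isotropy group at the unit $u$. An ample groupoid is a topological groupoid in which $\boldsymbol{s}$ is a local homeomorphism and $G^{(0)}$ is locally compact, totally disconnected and Hausdorff. The Steinberg algebra $A_R(G)$ is the $R$-module of locally constant, compactly supported functions $f:G\to R$ with convolution $f*g(x)=\sum_{y\in G_{\boldsymbol{s}(x)}}f(xy^{-1})g(y)$. $RG_u^u$ is the group $R$-algebra of $G_u^u$. Ideals are two-sided; $\mathcal{L}(A)$ is the set of ideals of a ring $A$. An arithmetical ring is a ring $A$ (not necessarily unital) whose lattice of ideals is distributive: $I\cap(J+K)=(I\cap J)+(I\cap K)$ for all $I,J,K\in\mathcal{L}(A)$. *)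

(* Defs.v *)
From HB Require Import structures.
From mathcomp Require Import all_boot all_order all_algebra.
From mathcomp Require Import all_classical topology.

Set Implicit Arguments.
Unset Strict Implicit.
Unset Printing Implicit Defensive.

Import GRing.Theory.
Local Open Scope classical_set_scope.
Local Open Scope ring_scope.

HB.mixin Record Zmodule_isNonUnitalRing A of GRing.Zmodule A := {
  nmul : A -> A -> A;
  nmulA : associative nmul;
  nmulDl : left_distributive nmul +%R;
  nmulDr : right_distributive nmul +%R }.

#[short(type="nonUnitalRingType")]
HB.structure Definition NonUnitalRing :=
  {A of Zmodule_isNonUnitalRing A & GRing.Zmodule A}.

Section Ideals.
Context {A : nonUnitalRingType}.
Implicit Types I J K : set A.

Definition two_sided_ideal I : Prop :=
  [/\ I 0, forall x y, I x -> I y -> I (x - y)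
    & forall a x, I x -> I (nmul a x) /\ I (nmul x a)].

Definition ideal_add I J : set A := [set x + y | x in I & y in J].

Definition ideal_mul I J : set A :=
  [set a | exists (n : nat) (x y : 'I_n -> A),
     [/\ forall i, I (x i), forall i, J (y i)
       & a = \sum_(i < n) nmul (x i) (y i)]].

End Ideals.

Definition arithmetical (A : nonUnitalRingType) : Prop :=
  forall I J K : set A,
    two_sided_ideal I -> two_sided_ideal J -> two_sided_ideal K ->
    I `&` ideal_add J K = ideal_add (I `&` J) (I `&` K).

(* Hahn's axioms for a groupoid.  The product is a total function whose value
   at (x, y) is meaningful only when x and y are composable; by composableE
   below, this means that the source of x is the range of y. *)
HB.mixin Record isGroupoid G := {
  composable : G -> G -> Prop;
  gmul : G -> G -> G;
  ginv : G -> G;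
  ginvK : involutive ginv;
  gmulA : forall x y z, composable x y -> composable y z ->
    [/\ composable (gmul x y) z, composable x (gmul y z)
      & gmul (gmul x y) z = gmul x (gmul y z)];
  composableVg : forall x, composable (ginv x) x;
  gmulKg : forall x y, composable x y -> gmul (ginv x) (gmul x y) = y;
  gmulgK : forall x y, composable x y -> gmul (gmul x y) (ginv y) = x }.

#[short(type="groupoidType")]
HB.structure Definition Groupoid := {G of isGroupoid G & Choice G}.

Arguments gmulA {s x y z}.
Arguments gmulKg {s x y}.
Arguments gmulgK {s x y}.

Section GroupoidTheory.
Context {G : groupoidType}.
Implicit Types x y z u : G.

Definition gsrc x : G := gmul (ginv x) x.
Definition grng x : G := gmul x (ginv x).

Lemma composablegV x : composable x (ginv x).
Proof. by have := composableVg (ginv x); rewrite ginvK. Qed.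

Lemma grngK x : gmul (grng x) x = x.
Proof. by have := gmulgK (composablegV x); rewrite ginvK. Qed.

Lemma gsrcK x : gmul x (gsrc x) = x.
Proof. by have := gmulKg (composableVg x); rewrite ginvK. Qed.

Lemma composable_rng x : composable (grng x) x.
Proof. by have [] := gmulA (composablegV x) (composableVg x). Qed.

Lemma composable_src x : composable x (gsrc x).
Proof. by have [] := gmulA (composablegV x) (composableVg x). Qed.

Lemma composableE x y : composable x y <-> gsrc x = grng y.
Proof.
split=> [xy|e].
  have [_ + _] := gmulA (composableVg x) xy.
  have [h1 _ h3] := gmulA (composableVg x) xy => _.
  by have := gmulgK h1; rewrite h3 gmulKg.
have := composable_src x; rewrite e => h.
have [+ _ _] := gmulA h (composable_rng y).
by rewrite -e gsrcK.
Qed.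

Lemma gsrcV x : gsrc (ginv x) = grng x.
Proof. by rewrite /gsrc ginvK. Qed.

Lemma grngV x : grng (ginv x) = gsrc x.
Proof. by rewrite /grng ginvK. Qed.

Lemma gsrcM x y : gsrc x = grng y -> gsrc (gmul x y) = gsrc y.
Proof.
move=> /composableE xy; have [+ _ _] := gmulA xy (composablegV y).
by move=> /composableE ->; rewrite grngV.
Qed.

Lemma grngM x y : gsrc x = grng y -> grng (gmul x y) = grng x.
Proof.
move=> /composableE xy; have [_ + _] := gmulA (composableVg x) xy.
by move=> /composableE <-; rewrite gsrcV.
Qed.

Lemma gmulgA x y z : gsrc x = grng y -> gsrc y = grng z ->
  gmul (gmul x y) z = gmul x (gmul y z).
Proof. by move=> /composableE xy /composableE yz; have [] := gmulA xy yz. Qed.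

Lemma gmulVKg x y : grng x = grng y -> gmul x (gmul (ginv x) y) = y.
Proof.
by move=> e; rewrite -gmulgA ?gsrcV ?grngV// -/(grng x) e grngK.
Qed.

Lemma gmulgVK x y : gsrc x = gsrc y -> gmul (gmul x (ginv y)) y = x.
Proof.
by move=> e; rewrite gmulgA ?gsrcV ?grngV// -/(gsrc y) -e gsrcK.
Qed.

Lemma gsrc_src x : gsrc (gsrc x) = gsrc x.
Proof. by rewrite {2}/gsrc gsrcM// gsrcV. Qed.

Lemma grng_src x : grng (gsrc x) = gsrc x.
Proof. by rewrite {2}/gsrc grngM ?gsrcV// grngV. Qed.

Lemma ginvM x y : gsrc x = grng y ->
  ginv (gmul x y) = gmul (ginv y) (ginv x).
Proof.
move=> e.
have sV : gsrc (ginv y) = grng (ginv x) by rewrite gsrcV grngV.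
have h : gsrc (gmul (ginv y) (ginv x)) = grng (gmul x y).
  by rewrite gsrcM// gsrcV grngM.
have := gmulgK (iffRL (composableE _ _) h).
have -> : gmul (gmul (ginv y) (ginv x)) (gmul x y) = gsrc y.
  rewrite gmulgA// ?gsrcV ?grngM// gmulKg//; exact/composableE.
move=> <-.
have -> : gsrc y = grng (ginv (gmul x y)) by rewrite grngV gsrcM.
by rewrite grngK.
Qed.

Definition unit_space : set G := range gsrc.

Lemma unit_src u : unit_space u -> gsrc u = u.
Proof. by move=> [x _ <-]; exact: gsrc_src. Qed.

Lemma unit_rng u : unit_space u -> grng u = u.
Proof. by move=> [x _ <-]; exact: grng_src. Qed.

Definition to_unit_space x : unit_space :=
  exist _ (gsrc x) (mem_set (imageP gsrc I)).

Definition isotropy (u : unit_space) : Type :=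
  [set x | gsrc x = val u /\ grng x = val u].

End GroupoidTheory.
Arguments unit_space : clear implicits.

Section Isotropy.
Context {G : groupoidType} (u : unit_space G).
Local Notation H := (isotropy u).

HB.instance Definition _ := Choice.copy H
  (set_type [set x | gsrc x = val u /\ grng x = val u]).

Lemma isotropy_src (x : H) : gsrc (val x) = val u.
Proof. by have /set_mem[] := valP x. Qed.

Lemma isotropy_rng (x : H) : grng (val x) = val u.
Proof. by have /set_mem[] := valP x. Qed.

Definition isotropy_mk x (h : gsrc x = val u /\ grng x = val u) : H :=
  exist _ x (mem_set h).

Fact isotropy_mul_subproof (x y : H) :
  gsrc (gmul (val x) (val y)) = val u /\ grng (gmul (val x) (val y)) = val u.
Proof.
have e : gsrc (val x) = grng (val y) by rewrite isotropy_src isotropy_rng.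
by rewrite gsrcM// grngM// isotropy_src isotropy_rng.
Qed.

Fact isotropy_inv_subproof (x : H) :
  gsrc (ginv (val x)) = val u /\ grng (ginv (val x)) = val u.
Proof. by rewrite gsrcV grngV isotropy_src isotropy_rng. Qed.

Fact isotropy_one_subproof :
  gsrc (val u) = val u /\ grng (val u) = val u.
Proof. by have /set_mem h := valP u; rewrite unit_src// unit_rng. Qed.

Definition isotropy_mul (x y : H) : H := isotropy_mk (isotropy_mul_subproof x y).
Definition isotropy_inv (x : H) : H := isotropy_mk (isotropy_inv_subproof x).
Definition isotropy_one : H := isotropy_mk isotropy_one_subproof.

Fact isotropy_mulA : associative isotropy_mul.
Proof.
move=> x y z; apply: val_inj => /=.
by rewrite gmulgA// isotropy_src isotropy_rng.
Qed.

Fact isotropy_mul1 : left_id isotropy_one isotropy_mul.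
Proof.
move=> x; apply: val_inj; apply: etrans (grngK (val x)) => /=.
by rewrite isotropy_rng.
Qed.

Fact isotropy_mulr1 : right_id isotropy_one isotropy_mul.
Proof.
move=> x; apply: val_inj; apply: etrans (gsrcK (val x)) => /=.
by rewrite isotropy_src.
Qed.

Fact isotropy_mulV : left_inverse isotropy_one isotropy_inv isotropy_mul.
Proof. by move=> x; apply: val_inj; exact: isotropy_src. Qed.

Fact isotropy_mulrV : right_inverse isotropy_one isotropy_inv isotropy_mul.
Proof. by move=> x; apply: val_inj; exact: isotropy_rng. Qed.

HB.instance Definition _ := isGroup.Build H isotropy_mulA isotropy_mul1
  isotropy_mulr1 isotropy_mulV isotropy_mulrV.

End Isotropy.

Section Convolution.
Context {G : groupoidType} {R : comPzRingType}.
Implicit Types (f g h : G -> R) (x y z u : G).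

(* \sum_(y \in A) is a finitely supported sum (0 if the support is infinite);
   supports are finite here when g is row_finite, see steinberg_row_finite. *)
Definition convolution f g : G -> R := fun x =>
  \sum_(y \in [set y | gsrc y = gsrc x]) f (gmul x (ginv y)) * g y.

Definition row_finite g :=
  forall u, finite_set [set y | gsrc y = u /\ g y != 0].

Lemma convolution_widen (A : set G) f g x :
  A `<=` [set y | gsrc y = gsrc x] ->
  (forall y, gsrc y = gsrc x -> g y != 0 -> A y) ->
  convolution f g x = \sum_(y \in A) f (gmul x (ginv y)) * g y.
Proof.
move=> sA Ag; rewrite /convolution; apply/esym/fsbig_widen => //.
move=> y [/= sy nAy]; have [->|gy] := eqVneq (g y) 0; first by rewrite mulr0.
by case: nAy; exact: Ag.
Qed.

Definition mul_support g h u : set G := \bigcup_(z in [set z | gsrc z = u /\ h z != 0])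
  ((fun y => gmul y z) @` [set y | gsrc y = grng z /\ g y != 0]).

Lemma mul_support_finite g h u : row_finite g -> row_finite h ->
  finite_set (mul_support g h u).
Proof.
by move=> fg fh; apply: bigcup_finite => // z _; exact: finite_image.
Qed.

Lemma mul_support_src g h u : mul_support g h u `<=` [set y | gsrc y = u].
Proof.
by move=> _ [z [zu _]] [y [yz _] <-] /=; rewrite gsrcM.
Qed.

Lemma mul_supportP g h z w : gsrc z = gsrc w -> h z != 0 ->
  g (gmul w (ginv z)) != 0 -> mul_support g h (gsrc w) w.
Proof.
move=> zw hz gwz; exists z => //; exists (gmul w (ginv z)).
  by split=> //; rewrite gsrcM ?gsrcV// grngV.
by rewrite gmulgVK.
Qed.

Lemma convolution_neq0 g h w :
  convolution g h w != 0 -> mul_support g h (gsrc w) w.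
Proof.
move=> ghw.
have [z zw] := (@fsbigN1 _ _ _ unit _ _ (fun _ y => g (gmul w (ginv y)) * h y) tt ghw).
move=> gh0; apply: (mul_supportP zw).
  by apply: contra_neq gh0 => ->; rewrite mulr0.
by apply: contra_neq gh0 => ->; rewrite mul0r.
Qed.

Lemma convolution_row_finite g h :
  row_finite g -> row_finite h -> row_finite (convolution g h).
Proof.
move=> fg fh u; apply: (sub_finite_set _ (mul_support_finite u fg fh)).
by move=> w [<-]; exact: convolution_neq0.
Qed.

Lemma fsum_mull (I : choiceType) (A : set I) (F : I -> R) a : finite_set A ->
  a * (\sum_(i \in A) F i) = \sum_(i \in A) a * F i.
Proof. by move=> fA; rewrite !fsbig_finite// mulr_sumr. Qed.

Lemma fsum_mulr (I : choiceType) (A : set I) (F : I -> R) a : finite_set A ->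
  (\sum_(i \in A) F i) * a = \sum_(i \in A) F i * a.
Proof. by move=> fA; rewrite !fsbig_finite// mulr_suml. Qed.

Lemma convolutionA f g h : row_finite g -> row_finite h ->
  convolution f (convolution g h) = convolution (convolution f g) h.
Proof.
move=> fg fh; apply/funext => x.
pose Z := [set z | gsrc z = gsrc x /\ h z != 0].
pose W := mul_support g h (gsrc x).
have fZ : finite_set Z by exact: fh.
have fW : finite_set W by exact: mul_support_finite.
have sW w : W w -> gsrc w = gsrc x by move/mul_support_src.
have sZ : Z `<=` [set z | gsrc z = gsrc x] by move=> z [].
have WP w : gsrc w = gsrc x -> convolution g h w != 0 -> W w.
  by move=> wx /convolution_neq0; rewrite wx.
have ZP z : gsrc z = gsrc x -> h z != 0 -> Z z by [].
rewrite (convolution_widen f sW WP) (convolution_widen _ sZ ZP).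
transitivity (\sum_(w \in W) \sum_(z \in Z)
    f (gmul x (ginv w)) * (g (gmul w (ginv z)) * h z)).
  apply: eq_fsbigr => w /set_mem Ww.
  rewrite (@convolution_widen Z); first exact: fsum_mull.
    by move=> z [/= -> _]; rewrite sW.
  by move=> z zw hz; split=> //; rewrite zw sW.
rewrite exchange_fsbig//; apply: eq_fsbigr => z /set_mem [zx hz].
have sz : gsrc (gmul x (ginv z)) = grng z by rewrite gsrcM ?gsrcV// grngV.
have -> : convolution f g (gmul x (ginv z)) =
    \sum_(w \in W) f (gmul x (ginv w)) * g (gmul w (ginv z)).
  rewrite /convolution sz.
  rewrite (@reindex_fsbig _ _ _ _ _ (fun w => gmul w (ginv z))
      [set w | gsrc w = gsrc x]); last first.
    split.
    - by move=> w /= wx; rewrite gsrcM ?gsrcV// grngV wx zx.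
    - move=> w w' /set_mem/= wx /set_mem/= wx' e.
      by rewrite -(@gmulgVK _ w z) ?wx// e gmulgVK ?wx'.
    - move=> y /= yz; exists (gmul y z); first by rewrite /= gsrcM.
      by apply: gmulgK; exact/composableE.
  rewrite [RHS](@fsbig_widen _ _ _ _ _ [set w | gsrc w = gsrc x])//.
    apply: eq_fsbigr => w /set_mem/= wx; congr (f _ * _).
    rewrite ginvM ?grngV ?wx// ginvK -gmulgA; first last.
    - by rewrite grngV wx.
    - by rewrite gsrcM ?gsrcV// grngV.
    by rewrite gmulgVK.
  move=> w [/= wx nWw]; have [->|gw] := eqVneq (g (gmul w (ginv z))) 0.
    by rewrite mulr0.
  by case: nWw; rewrite /W -wx; apply: (mul_supportP _ hz gw); rewrite wx.
rewrite fsum_mulr//; apply: eq_fsbigr => w _; exact: mulrA.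
Qed.

Lemma convolutionDl f g h : row_finite h ->
  convolution (f + g) h = convolution f h + convolution g h.
Proof.
move=> fh; apply/funext => x; rewrite [RHS]/GRing.add/=.
pose Z := [set z | gsrc z = gsrc x /\ h z != 0].
have Zx : Z `<=` [set y | gsrc y = gsrc x] by move=> z [].
have Zh z : gsrc z = gsrc x -> h z != 0 -> Z z by [].
rewrite !(convolution_widen _ Zx Zh) -fsbig_split; last exact: fh.
by apply: eq_fsbigr => z _; exact: mulrDl.
Qed.

Lemma convolutionDr f g h : row_finite g -> row_finite h ->
  convolution f (g + h) = convolution f g + convolution f h.
Proof.
move=> fg fh; apply/funext => x; rewrite [RHS]/GRing.add/=.
pose Y := [set z | gsrc z = gsrc x /\ g z != 0].
pose Z := [set z | gsrc z = gsrc x /\ h z != 0].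
have sYZ : Y `|` Z `<=` [set y | gsrc y = gsrc x] by move=> z [[]|[]].
rewrite !(convolution_widen _ sYZ).
- rewrite -fsbig_split; last by rewrite finite_setU; split; [exact: fg|exact: fh].
  by apply: eq_fsbigr => z _; exact: mulrDr.
- by move=> z zx hz; right.
- by move=> z zx hz; left.
- move=> z zx; have [gz|gz _] := eqVneq (g z) 0; last by left.
  have [hz|hz _] := eqVneq (h z) 0; last by right.
  by rewrite [(g + h) z]/GRing.add/= gz hz addr0 eqxx.
Qed.

End Convolution.

(* Used only to obtain the ring axioms of the group algebra from those of the
   groupoid convolution. *)
Definition group_groupoid (H : groupType) : Type := H.

Section GroupGroupoid.
Context {H : groupType}.
Local Open Scope group_scope.

HB.instance Definition _ := Choice.copy (group_groupoid H) H.

Fact group_groupoidA (x y z : group_groupoid H) : True -> True ->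
  [/\ True, True & (x * y : H) * z = x * (y * z : H)].
Proof. by rewrite mulgA. Qed.

HB.instance Definition _ := isGroupoid.Build (group_groupoid H)
  (composable := fun _ _ => True) (gmul := fun x y : H => x * y)
  (ginv := fun x : H => x^-1) (@invgK H) group_groupoidA
  (fun _ => Logic.I) (fun x y _ => mulKg x y) (fun x y _ => mulgK y x).

End GroupGroupoid.

Section GroupAlgebra.
Context {R : comPzRingType} {H : groupType}.
Implicit Types f g : H -> R.

Definition group_convolution f g : H -> R := fun x =>
  \sum_(y \in [set: H]) f (x * y^-1)%g * g y.

Definition finitely_supported : {pred H -> R} :=
  mem [set f : H -> R | finite_set [set x | f x != 0]].

Fact finitely_supported_zmod_closed : zmod_closed finitely_supported.
Proof.
split.
  rewrite inE/= (_ : [set x | _] = set0); first exact: finite_set0.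
  by apply/seteqP; split => // x /=; rewrite eqxx.
move=> f g; rewrite !inE/= => ff fg.
have : finite_set ([set x | f x != 0] `|` [set x | g x != 0]).
  by rewrite finite_setU.
apply: sub_finite_set => x /=.
have [fx|fx _] := eqVneq (f x) 0; last by left.
have [gx|gx _] := eqVneq (g x) 0; last by right.
by rewrite [(f - g) x]/GRing.add/= [(- g) x]/GRing.opp/= fx gx subr0 eqxx.
Qed.

HB.instance Definition _ :=
  GRing.isZmodClosed.Build _ finitely_supported finitely_supported_zmod_closed.

Lemma group_convolutionE f g :
  group_convolution f g = @convolution (group_groupoid H) R f g.
Proof.
apply/funext => x; rewrite /group_convolution /convolution.
apply: eq_fsbigl; apply/seteqP; split=> // y _ /=.
by rewrite /gsrc /gmul/= /ginv/= !mulVg.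
Qed.

Lemma finitely_supported_row_finite f :
  f \in finitely_supported -> @row_finite (group_groupoid H) R f.
Proof.
by rewrite inE/= => ff u; apply: sub_finite_set ff => x [].
Qed.

Lemma row_finite_finitely_supported f :
  @row_finite (group_groupoid H) R f -> f \in finitely_supported.
Proof.
move=> /(_ 1%g) ff; rewrite inE/=; apply: sub_finite_set ff => x /= fx.
by split=> //; rewrite /gsrc /gmul/= /ginv/= mulVg.
Qed.

Fact group_convolution_closed f g : f \in finitely_supported ->
  g \in finitely_supported -> group_convolution f g \in finitely_supported.
Proof.
move=> /finitely_supported_row_finite ff /finitely_supported_row_finite fg.
rewrite group_convolutionE; apply: row_finite_finitely_supported.
exact: convolution_row_finite.
Qed.

End GroupAlgebra.

Record group_algebra (R : comPzRingType) (H : groupType) := GroupAlgebra {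
  group_algebra_fun :> H -> R;
  group_algebraP : group_algebra_fun \in finitely_supported }.

Section GroupAlgebraRing.
Context {R : comPzRingType} {H : groupType}.
Local Notation A := (group_algebra R H).

HB.instance Definition _ := [isSub for @group_algebra_fun R H].
HB.instance Definition _ := [Choice of A by <:].
HB.instance Definition _ := [SubChoice_isSubZmodule of A by <:].

Definition group_algebra_mul (a b : A) : A :=
  GroupAlgebra (group_convolution_closed (group_algebraP a) (group_algebraP b)).

Local Notation rf a := (finitely_supported_row_finite (group_algebraP a)).

Fact group_algebra_mulA : associative group_algebra_mul.
Proof.
move=> a b c; apply: val_inj; rewrite /= !group_convolutionE.
exact: convolutionA (rf b) (rf c).
Qed.

Fact group_algebra_mulDl : left_distributive group_algebra_mul +%R.
Proof.
move=> a b c; apply: val_inj; rewrite /= !group_convolutionE.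
exact: convolutionDl (rf c).
Qed.

Fact group_algebra_mulDr : right_distributive group_algebra_mul +%R.
Proof.
move=> a b c; apply: val_inj; rewrite /= !group_convolutionE.
exact: convolutionDr (rf b) (rf c).
Qed.

HB.instance Definition _ := Zmodule_isNonUnitalRing.Build A
  group_algebra_mulA group_algebra_mulDl group_algebra_mulDr.

End GroupAlgebraRing.

(* The inverse g of f on f @` U is extended arbitrarily to Y. *)
Definition local_homeomorphism {X Y : topologicalType} (f : X -> Y) : Prop :=
  forall x, exists U : set X, [/\ open U, U x, open (f @` U)
    & exists g : Y -> X, [/\ {within U, continuous f},
        {within f @` U, continuous g} & {in U, cancel f g}]].

HB.mixin Record isTopologicalGroupoid G of Topological G & Groupoid G := {
  ginv_continuous : continuous (ginv : G -> G);
  gmul_continuous : {within [set p : G * G | composable p.1 p.2],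
    continuous (fun p : G * G => gmul p.1 p.2)} }.

#[short(type="topologicalGroupoidType")]
HB.structure Definition TopologicalGroupoid :=
  {G of isTopologicalGroupoid G & Topological G & Groupoid G}.

(* unit_space G, a set_type, carries the topology induced by G. *)
HB.mixin Record isAmple G of TopologicalGroupoid G := {
  gsrc_local_homeomorphism : local_homeomorphism (@to_unit_space G);
  unit_space_locally_compact : locally_compact [set: unit_space G];
  unit_space_totally_disconnected : totally_disconnected [set: unit_space G];
  unit_space_hausdorff : hausdorff_space (unit_space G) }.

#[short(type="ampleGroupoidType")]
HB.structure Definition AmpleGroupoid :=
  {G of isAmple G & TopologicalGroupoid G}.

HB.mixin Record isHausdorff G of Topological G := {
  groupoid_hausdorff : hausdorff_space G }.

#[short(type="hausdorffAmpleGroupoidType")]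
HB.structure Definition HausdorffAmpleGroupoid :=
  {G of isHausdorff G & AmpleGroupoid G}.

Section SteinbergPred.
Context {R : comPzRingType} {G : topologicalGroupoidType}.

Definition locally_constant (f : G -> R) : Prop :=
  forall x, \forall y \near x, f y = f x.

(* The support is already closed: see locally_constant_closed. *)
Definition steinberg_pred : {pred G -> R} := mem [set f : G -> R |
  locally_constant f /\ compact [set x | f x != 0]].

Lemma locally_constant_closed f :
  locally_constant f -> closed [set x | f x != 0].
Proof.
move=> fl; rewrite (_ : [set x | _] = ~` [set x | f x = 0]).
  apply: open_closedC; rewrite openE => x /= fx.
  by apply: filterS (fl x) => y /= ->.
by apply/seteqP; split=> x /= /eqP.
Qed.

Fact steinberg_zmod_closed : zmod_closed steinberg_pred.
Proof.
split.
  rewrite inE/=; split; first by move=> x; exact: nearW.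
  rewrite (_ : [set x | _] = set0); first exact: compact0.
  by apply/seteqP; split => // x /=; rewrite eqxx.
move=> f g; rewrite !inE/= => -[fl fc] [gl gc].
have fgE x : (f - g) x = f x - g x by [].
have fgl : locally_constant (f - g).
  move=> x; apply: filterS2 (fl x) (gl x) => y fy gy.
  by rewrite !fgE fy gy.
split=> //; apply: (subclosed_compact (locally_constant_closed fgl)).
  exact: compactU fc gc.
move=> x /=.
have [fx|fx _] := eqVneq (f x) 0; last by left.
have [gx|gx _] := eqVneq (g x) 0; last by right.
by rewrite fgE fx gx subr0 eqxx.
Qed.

HB.instance Definition _ :=
  GRing.isZmodClosed.Build _ steinberg_pred steinberg_zmod_closed.

End SteinbergPred.

Section GroupoidTopology.

Section Topological.
Context {G : topologicalGroupoidType}.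

Lemma cvg_gmul (T : Type) (F : set_system T) (a b : T -> G) (x y : G) :
  Filter F -> a @ F --> x -> b @ F --> y -> composable x y ->
  (\forall t \near F, composable (a t) (b t)) ->
  gmul (a t) (b t) @[t --> F] --> gmul x y.
Proof.
move=> FF ax yb xy ab U nU.
have /subspace_continuousP/(_ (x, y) xy U nU) h := @gmul_continuous G.
by apply: filterS2 ab (cvg_pair ax yb h) => t /= ab; exact.
Qed.

Lemma gsrc_continuous : continuous (gsrc : G -> G).
Proof.
move=> x; apply: cvg_gmul; first exact: ginv_continuous.
- exact: cvg_id.
- exact: composableVg.
- by apply: nearW => t; exact: composableVg.
Qed.

Lemma grng_continuous : continuous (grng : G -> G).
Proof.
rewrite (_ : grng = gsrc \o ginv); last by apply/funext => y /=; rewrite gsrcV.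
by move=> x; apply: continuous_comp; [exact: ginv_continuous|exact: gsrc_continuous].
Qed.

Lemma to_unit_space_continuous : continuous (@to_unit_space G).
Proof.
move=> x U [B [[C oC <-] /= Cx BU]].
have : nbhs (gsrc x : G) C by exact: (@open_nbhs_nbhs G) (conj oC Cx).
move=> nC; apply: (@filterS _ (nbhs x) _ (gsrc @^-1` C)) => [y Cy|].
  exact: BU.
exact: gsrc_continuous nC.
Qed.

End Topological.

Lemma local_section {G : ampleGroupoidType} (y : G) :
  exists Vt : set G * (G -> G),
  [/\ nbhs y Vt.1,
      forall x z, Vt.1 z -> gsrc z = gsrc x -> z = Vt.2 x
    & forall x, gsrc x = gsrc y -> Vt.2 t @[t --> x] --> y /\
        \forall t \near x, gsrc (Vt.2 t) = gsrc t].
Proof.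
have [U [oU Uy ofU [g [_ gc fK]]]] := gsrc_local_homeomorphism y.
have fE (a b : G) : gsrc a = gsrc b -> to_unit_space a = to_unit_space b.
  by move=> ab; apply: val_inj.
exists (U, g \o @to_unit_space G) => /=; split.
- exact: open_nbhs_nbhs.
- move=> x z Uz zx; rewrite /= -(fE _ _ zx) fK//; exact: mem_set.
move=> x xy; have nfU : nbhs (to_unit_space x) ((@to_unit_space G) @` U).
  by apply: open_nbhs_nbhs; split => //; exists y => //; exact/esym/fE.
split.
  have /subspace_continuousP/(_ (to_unit_space x)) := gc.
  move=> /(_ (nbhs_singleton nfU)) gx W nW.
  have gxy : g (to_unit_space x) = y by rewrite (fE _ _ xy) fK//; exact: mem_set.
  rewrite -gxy in nW; have := gx W nW; rewrite nbhs_simpl /within/= => h.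
  have : nbhs (to_unit_space x) (g @^-1` W).
    by apply: filterS2 nfU h => p fUp; exact.
  exact: to_unit_space_continuous.
have : nbhs x (@to_unit_space G @^-1` ((@to_unit_space G) @` U)).
  exact: to_unit_space_continuous.
apply: filterS => t [z Uz zt].
by rewrite /= -zt fK ?(mem_set Uz)//; have := congr1 val zt.
Qed.

Lemma near_finite (T : topologicalType) (I : choiceType) (A : set I) (x : T)
    (P : I -> T -> Prop) : finite_set A ->
  (forall i, A i -> \forall t \near x, P i t) ->
  \forall t \near x, forall i, A i -> P i t.
Proof.
move=> /finite_fsetP[X ->] AP.
exact: (@filter_bigI T I X P (nbhs x) _ AP).
Qed.

Lemma compact_fiber_finite {G : ampleGroupoidType} (K : set G) (u : G) :
  compact K -> finite_set [set y | gsrc y = u /\ K y].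
Proof.
move=> /compact_near_coveringP Kc.
pose F := filter_from [set A : set G | finite_set A]
  (fun A => [set B : set G | A `<=` B]).
have FF : Filter F.
  apply: filter_from_filter; first by exists set0; exact: finite_set0.
  move=> A B fA fB; exists (A `|` B); first by rewrite /= finite_setU.
  by move=> C; rewrite /= subUset.
have [A fA AK] : \forall B \near F, K `<=` (fun y => gsrc y = u -> B y).
  apply: (Kc _ _ (fun B y => gsrc y = u -> B y)) => y Ky.
  have [[V t] /= [nV Vt _]] := local_section y.
  exists (V, [set B | [set z | V z /\ gsrc z = u] `<=` B]); last first.
    by move=> [z B] [/= Vz VB] zu; exact: VB.
  split=> //=; exists [set z | V z /\ gsrc z = u] => //=.
  have [[x xu]|nx] := pselect (exists x, gsrc x = u).
    apply: (sub_finite_set _ (finite_set1 (t x))) => z [Vz zu].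
    by apply: Vt => //; rewrite zu.
  apply: (@sub_finite_set _ _ set0); last exact: finite_set0.
  by move=> z [_ zu]; apply: nx; exists z.
apply: (sub_finite_set _ fA) => y [yu Ky].
exact: AK (subset_refl _) _ Ky yu.
Qed.

Context {R : comPzRingType} {G : hausdorffAmpleGroupoidType}.
Implicit Types f g : G -> R.

Lemma neq_near (T : topologicalType) (a b : T -> G) (t : T) (x y : G) :
  a @ t --> x -> b @ t --> y -> x <> y -> \forall s \near t, a s <> b s.
Proof.
move=> ax yb /eqP xy; have := @groupoid_hausdorff G.
rewrite open_hausdorff => /(_ _ _ xy) [[A B] /= [Ax By] [oA oB AB0]].
have nA : nbhs x A by apply: open_nbhs_nbhs; split => //; exact: set_mem.
have nB : nbhs y B by apply: open_nbhs_nbhs; split => //; exact: set_mem.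
have {}ax : \forall s \near t, A (a s) by exact: ax.
have {}yb : \forall s \near t, B (b s) by exact: yb.
apply: filterS2 ax yb => s As Bs e.
by have /eqP/seteqP[/(_ (a s)) + _] := AB0; apply; split => //; rewrite e.
Qed.

Lemma composable_closed : closed [set p : G * G | composable p.1 p.2].
Proof.
rewrite (_ : mkset _ = ~` [set p : G * G | gsrc p.1 <> grng p.2]).
  apply: open_closedC; rewrite openE => p /= pN.
  apply: (@neq_near _ (fun q : G * G => gsrc q.1) (fun q => grng q.2) _ _ _ _ _ pN).
    by apply: (@cvg_comp _ _ _ fst gsrc); [exact: cvg_fst|exact: gsrc_continuous].
  by apply: (@cvg_comp _ _ _ snd grng); [exact: cvg_snd|exact: grng_continuous].
apply/seteqP; split=> p /=; first by move=> /composableE e; apply.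
by move=> /contrapT /composableE.
Qed.

Lemma steinberg_row_finite f : f \in steinberg_pred -> row_finite f.
Proof.
by rewrite inE/= => -[_ fc] u; exact: (compact_fiber_finite u fc).
Qed.

Lemma convolution_locally_constant f g : f \in steinberg_pred ->
  g \in steinberg_pred -> locally_constant (convolution f g).
Proof.
rewrite !inE => -[fl _] [gl gc] x0.
pose S := [set y | gsrc y = gsrc x0 /\ g y != 0].
have fS : finite_set S by exact: (compact_fiber_finite (gsrc x0) gc).
have [Vt VtP] := choice (@local_section G).
pose t y x := (Vt y).2 x.
have tcvg y : S y -> t y x @[x --> x0] --> y.
  by move=> [yx _]; have [_ _ /(_ x0 (esym yx))[]] := VtP y.
have ts y : S y -> \forall x \near x0, gsrc (t y x) = gsrc x.
  by move=> [yx _]; have [_ _ /(_ x0 (esym yx))[]] := VtP y.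
have cover : \forall x \near x0, forall z, g z != 0 -> gsrc z = gsrc x ->
    exists2 y, S y & t y x = z.
  move/compact_near_coveringP : gc => /(_ _ (nbhs x0) (fun x z =>
    gsrc z = gsrc x -> exists2 y, S y & t y x = z)); apply => z gz.
  have [zx|zx] := pselect (gsrc z = gsrc x0).
    have [nV Vt1 _] := VtP z.
    exists ((Vt z).1, setT); first by split => //; exact: filterT.
    by move=> [z' x] [/= Vz' _] z'x; exists z => //; exact/esym/Vt1.
  apply: filterS (@neq_near _ (fun q : G * G => gsrc q.1)
    (fun q => gsrc q.2) (z, x0) _ _ _ _ zx) => //.
    by apply: (@cvg_comp _ _ _ fst gsrc); [exact: cvg_fst|exact: gsrc_continuous].
  by apply: (@cvg_comp _ _ _ snd gsrc); [exact: cvg_snd|exact: gsrc_continuous].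
have tinj : \forall x \near x0, forall y, S y -> forall y', S y' ->
    t y x = t y' x -> y = y'.
  apply: (near_finite fS) => y Sy; apply: (near_finite fS) => y' Sy'.
  have [->|yy'] := pselect (y = y'); first exact: nearW.
  by apply: filterS (neq_near (tcvg _ Sy) (tcvg _ Sy') yy').
have tval : \forall x \near x0, forall y, S y -> [/\ gsrc (t y x) = gsrc x,
    g (t y x) = g y & f (gmul x (ginv (t y x))) = f (gmul x0 (ginv y))].
  apply: (near_finite fS) => y Sy; apply: filterS3 (ts _ Sy) (tcvg _ Sy _ (gl y)) _.
    by move=> x sx gx fx; split; [exact: sx|exact: gx|exact: fx].
  have : gmul x (ginv (t y x)) @[x --> x0] --> gmul x0 (ginv y).
    apply: cvg_gmul.
    - exact: cvg_id.
    - by apply: (@cvg_comp _ _ _ (t y) ginv); [exact: tcvg|exact: ginv_continuous].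
    - by apply/composableE; rewrite grngV; case: Sy.
    - by apply: filterS (ts _ Sy) => x sx; apply/composableE; rewrite grngV.
  by move=> /(_ _ (fl (gmul x0 (ginv y)))).
apply: filterS3 cover tinj tval => x xcover xinj xval.
rewrite (@convolution_widen _ _ S _ _ x0); first last.
- by move=> z zx gz; split.
- by move=> z [].
rewrite (@convolution_widen _ _ ((t^~ x) @` S)).
- rewrite fsbig_image; last by move=> y y' /set_mem Sy /set_mem Sy'; exact: xinj.
  by apply: eq_fsbigr => y /set_mem /xval[_ -> ->].
- by move=> _ [y Sy <-] /=; have [] := xval _ Sy.
- by move=> z zx gz; exact: xcover.
Qed.

Fact convolution_steinberg f g : f \in steinberg_pred ->
  g \in steinberg_pred -> convolution f g \in steinberg_pred.
Proof.
move=> fA gA; have fgl := convolution_locally_constant fA gA.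
rewrite inE; split=> //.
pose K := ([set x | f x != 0] `*` [set x | g x != 0]) `&`
  [set p : G * G | composable p.1 p.2].
have sK : [set x | convolution f g x != 0] `<=`
    (fun p : G * G => gmul p.1 p.2) @` K.
  move=> w /= /convolution_neq0 [z [zw gz] [y [yz fy] <-]].
  by exists (y, z) => //; split => //; exact/composableE.
apply: (subclosed_compact (locally_constant_closed fgl) _ sK).
move: fA gA; rewrite !inE => -[_ fc] [_ gc].
apply: continuous_compact.
  by apply: continuous_subspaceW (@gmul_continuous G) => p [].
by apply: compact_closedI; [exact: compact_setX|exact: composable_closed].
Qed.

End GroupoidTopology.

Record steinberg (R : comPzRingType) (G : hausdorffAmpleGroupoidType) :=
  Steinberg {
    steinberg_fun :> G -> R;
    steinbergP : steinberg_fun \in steinberg_pred }.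

Section SteinbergRing.
Context {R : comPzRingType} {G : hausdorffAmpleGroupoidType}.
Local Notation A := (steinberg R G).

HB.instance Definition _ := [isSub for @steinberg_fun R G].
HB.instance Definition _ := [Choice of A by <:].
HB.instance Definition _ := [SubChoice_isSubZmodule of A by <:].

Definition steinberg_mul (a b : A) : A :=
  Steinberg (convolution_steinberg (steinbergP a) (steinbergP b)).

Local Notation rf a := (steinberg_row_finite (steinbergP a)).

Fact steinberg_mulA : associative steinberg_mul.
Proof. by move=> a b c; apply: val_inj; exact: convolutionA (rf b) (rf c). Qed.

Fact steinberg_mulDl : left_distributive steinberg_mul +%R.
Proof. by move=> a b c; apply: val_inj; exact: convolutionDl (rf c). Qed.

Fact steinberg_mulDr : right_distributive steinberg_mul +%R.
Proof. by move=> a b c; apply: val_inj; exact: convolutionDr (rf b) (rf c). Qed.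

HB.instance Definition _ := Zmodule_isNonUnitalRing.Build A
  steinberg_mulA steinberg_mulDl steinberg_mulDr.

End SteinbergRing.

(* Main.v *)
Require Import Defs.
From mathcomp Require Import all_boot all_order all_algebra.
From mathcomp Require Import finmap all_classical topology.

Set Implicit Arguments.
Unset Strict Implicit.
Unset Printing Implicit Defensive.

Import GRing.Theory.
Local Open Scope classical_set_scope.
Local Open Scope ring_scope.

(* An element [f] of the Steinberg algebra lies in an ideal [I] as soon as, for
   every unit [u], some element of [I] agrees with [f] on the fibre [G_u]: two
   elements agreeing on [G_u] agree over a neighbourhood of [u], and the support
   of [f] is compact.  On one fibre, multiplying by indicators of small compact
   open bisections cuts [f] into pieces with a single range [v] and translates
   these along [G] without leaving the ideal.  For (2), a piece is translated
   into [G_u^u], where the ideals of [A_R(G)] induce ideals of [R G_u^u]; for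
   (1), if [g] lives on [G_v^w] and [h] on [G_u^v], then for [c] in [G_v^w] and
   [b] in [G_u^v] one has [g h = (c h b^-1) (c^-1 g b)] on [G_u], since the
   isotropy at [v] is abelian. *)

(** * Compact open bases of totally disconnected, locally compact Hausdorff spaces *)

Section CompactOpenBasis.
Context {T : topologicalType}.
Implicit Types (A B K O : set T) (x : T).

(** Finitely many complements of closures of members of [F] cover [K], and the intersection of these
    members is the required set. Compactness is used in its near-covering form, along the filter of
    sets that shrink below every member of [F]. *)
Lemma compact_filter_disjoint (F : set_system T) K : Filter F -> compact K ->
  (forall x, K x -> exists2 U, F U & ~ closure U x) ->
  exists2 U, F U & K `&` closure U = set0.
Proof.
move=> FF /compact_near_coveringP Kc KF.
have FG : Filter (filter_from F (fun U => [set V | V `<=` U])).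
  apply: filter_from_filter; first by exists setT; exact: filterT.
  move=> U V FU FV; exists (U `&` V); first exact: filterI.
  by move=> W; rewrite /= subsetI.
have [x Kx|U FU UK] := Kc _ _ (fun U x => ~ closure U x) FG.
  have [U FU Ux] := KF x Kx.
  exists (~` closure U, [set V | V `<=` U]).
    split; last by exists U.
    apply: open_nbhs_nbhs; split => //.
    by apply: closed_openC; exact: closed_closure.
  by move=> [y V] [/= Uy /closureS VU]; apply: contra_not Uy; exact: VU.
exists U => //; rewrite -subset0 => x [Kx]; exact: UK.
Qed.

Context (hT : hausdorff_space T).

(** Compactness is used twice: a point [b] of [B] is separated from [A] by shrinking neighbourhoods
    of [b], then [B] is separated from [A] by shrinking neighbourhoods of [A]. *)
Lemma compact_hausdorff_separation A B : compact A -> compact B ->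
  A `&` B = set0 ->
  exists U, [/\ open U, A `<=` U & B `&` closure U = set0].
Proof.
move=> Ac Bc AB0.
have [b Bb|W AW WB] := @compact_filter_disjoint (set_nbhs A) B _ Bc.
  have [a Aa|V Vb AV] := @compact_filter_disjoint (nbhs b) A _ Ac.
    have ab : a != b.
      apply/eqP => ab; have := AB0; rewrite -subset0 => /(_ a); apply.
      by split; rewrite // ab.
    have := hT; rewrite open_hausdorff => /(_ _ _ ab) [[U V] /=].
    move=> [/set_mem Ua /set_mem Vb] [oU oV /eqP UV].
    exists V; first exact: open_nbhs_nbhs.
    move=> /(_ U (open_nbhs_nbhs (conj oU Ua))); rewrite setIC UV => -[].
    by [].
  exists (~` closure V).
    move=> a Aa; apply: open_nbhs_nbhs; split.
      exact/closed_openC/closed_closure.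
    by move=> Va; have := AV; rewrite -subset0 => /(_ a); apply.
  move=> /(_ V Vb) [t [+ Vt]]; apply; exact: subset_closure.
have [U [oU AU UW]] := (iffLR (set_nbhsP _ _)) AW.
exists U; split => //; rewrite -subset0 => x [Bx /(closureS UW) Wx].
by rewrite -WB.
Qed.

(** The relatively clopen subsets containing [x] of a compact neighbourhood [K] intersect in [{x}].
    By compactness one of them lies in the interior of the intersection of [O] and [K], which makes
    it open in [T] and not only in [K]. *)
Lemma compact_open_basis x O : locally_compact [set: T] ->
  totally_disconnected [set: T] -> nbhs x O ->
  exists D, [/\ open D, compact D, D x & D `<=` O].
Proof.
move=> lc td xO.
have [K] := lc x Logic.I; rewrite withinET => xK [Kc Kcl].
(* As [K] is closed, being clopen in [K] means that [C] and its complement in [K] are closed in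
   [T]. *)
pose Cl C := [/\ C x, C `<=` K, closed C & closed (K `\` C)].
have ClK : Cl K.
  by split => //; [exact: nbhs_singleton|rewrite setDv; exact: closed0].
have ClI C D : Cl C -> Cl D -> Cl (C `&` D).
  move=> [Cx CK Ccl CC] [Dx DK Dcl DC]; split => //; first by move=> y [/CK].
  - exact: closedI.
  - by rewrite setDIr; exact: closedU.
have FCl : Filter (filter_from Cl id).
  apply: filter_from_filter; first by exists K.
  by move=> C D CC CD; exists (C `&` D) => //; exact: ClI.
(* The quasi-component of [x] in [K]; it is connected, hence equal to [{x}]. *)
pose Q := \bigcap_(C in Cl) C.
have QK : Q `<=` K by move=> y; exact.
have Qcl : closed Q by apply: closed_bigI => C [].
have QW W : open W -> Q `<=` W -> exists2 C, Cl C & C `<=` W.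
  move=> oW QW; have KW : compact (K `\` W).
    by apply: (subclosed_compact _ Kc) => //; apply: closedI => //;
      exact: open_closedC.
  have [y [Ky nWy]|U [C CC CU] UK] := @compact_filter_disjoint _ _ FCl KW.
    have [C CC nCy] : exists2 C, Cl C & ~ C y.
      apply: contrapT => nC; apply/nWy/QW => C CC; apply: contrapT => nCy.
      by apply: nC; exists C.
    exists C; first by exists C.
    by have [_ _ /closure_id <-] := CC.
  exists C => // y Cy; apply: contrapT => nWy.
  suff : set0 y by [].
  rewrite -UK; split; last exact/subset_closure/CU.
  by split => //; have [_ + _ _] := CC; exact.
have Qx : Q x by move=> C [].
have Qconn : connected Q.
  move=> B B0 [O' oO BO] [C clC BC].
  have Bcl : closed B by rewrite BC; exact: closedI.
  have Bc : compact B.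
    by apply: (subclosed_compact Bcl Kc) => y; rewrite BC => -[/QK].
  have QBE : Q `\` B = Q `\` O'.
    by apply/seteqP; split=> y [Qy By]; split => //; move: By;
      rewrite BO => + h; apply => //; case: h.
  have QBc : compact (Q `\` B).
    apply: (subclosed_compact _ Kc); last by move=> y [/QK].
    by rewrite QBE; apply: closedI => //; exact: open_closedC.
  have BQ : B `<=` Q by move=> y; rewrite BO => -[].
  (* The clopen set [D] avoids the boundary of [U], so its part in [U] is again clopen. That part
     contains [x], hence all of [Q], which leaves no room for [A2]. *)
  have part (A1 A2 : set T) : compact A1 -> compact A2 -> A1 `&` A2 = set0 ->
      Q = A1 `|` A2 -> A1 x -> Q = A1.
    move=> A1c A2c A12 QA A1x.
    have [U [oU A1U A2U]] := compact_hausdorff_separation A1c A2c A12.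
    have [|y|D CD DU] := QW (U `|` ~` closure U).
    - apply: openU => //; exact/closed_openC/closed_closure.
    - rewrite QA => -[/A1U|A2y]; first by left.
      by right => Uy; have := A2U; rewrite -subset0 => /(_ y); apply.
    have CDU : Cl (D `&` U).
      have [Dx DK Dcl DC] := CD.
      have E1 : D `&` U = D `&` closure U.
        apply/seteqP; split=> y [Dy Uy]; split => //;
          first exact: subset_closure.
        by have [] := DU y Dy.
      split; [by split => //; exact: A1U|by move=> y [/DK]| |].
        by rewrite E1; apply: closedI => //; exact: closed_closure.
      rewrite setDIr; apply: closedU => //.
      by apply: closedI => //; exact: open_closedC.
    apply/seteqP; split => y; last by rewrite QA; left.
    move=> Qy; have := Qy; rewrite {1}QA => -[//|A2y].
    have [_ Uy] := Qy _ CDU.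
    have := A2U; rewrite -subset0 => /(_ y) []; split => //;
      exact: subset_closure.
  have QE : Q = B `|` (Q `\` B) by rewrite setDUK.
  have BD0 : B `&` (Q `\` B) = set0 by rewrite setDIK.
  have [Bx|nBx] := pselect (B x); first exact/esym/(part _ _ Bc QBc).
  have /esym QB : Q = Q `\` B.
    by apply: (part (Q `\` B) B) => //; [rewrite setIC|rewrite setUC].
  by case: B0 => y By; have := BQ y By; rewrite -QB => -[].
have Q1 : Q `<=` [set x].
  by rewrite -(td x Logic.I); exact: connected_component_max.
have [|y /Q1 ->|D [Dx DK Dcl KD] DO] := QW (O `&` K)°;
  first exact: open_interior.
  by apply: nbhs_singleton; apply: nbhs_interior; exact: filterI.
exists D; split => //; [|exact: subclosed_compact Dcl Kc DK|].
  (* Around a point of [D] one can stay in the interior, hence in [K], and avoid the closed set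
     [K \ D]; what is left lies in [D]. *)
  rewrite openE => y Dy; rewrite /interior.
  have : nbhs y ((O `&` K)° `&` ~` (K `\` D)).
    apply: open_nbhs_nbhs; split; last by split; [exact: DO|case].
    by apply: openI; [exact: open_interior|exact: closed_openC].
  apply: filterS => z [/interior_subset[_ Kz] nz].
  by apply: contrapT => nDz; exact: nz.
by move=> y /DO /interior_subset [].
Qed.

End CompactOpenBasis.

(** * Local structure of ample groupoids *)

Section AmpleTopology.
Context {G : ampleGroupoidType}.
Implicit Types (x y z u : G) (O D : set G).

Lemma to_unit_spaceE x y : to_unit_space x = to_unit_space y <->
  gsrc x = gsrc y.
Proof. by split=> [/(congr1 val)|e] //; exact: val_inj. Qed.

Lemma gsrc_chart x : exists (U : set G) (g : unit_space G -> G),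
  [/\ open U, U x, open (@to_unit_space G @` U),
      {within @to_unit_space G @` U, continuous g}
    & forall z, U z -> g (to_unit_space z) = z].
Proof.
have [U [oU Ux ofU [g [_ gc fK]]]] := gsrc_local_homeomorphism x.
by exists U, g; split => // z Uz; rewrite fK//; exact: mem_set.
Qed.

(** A compact open set [C] of units is lifted by the local inverse [g] of the source map. The lift
    is compact by continuity of [g], and open because it is the part of [U] with source in [C]. *)
Lemma ample_compact_open_basis x O : nbhs x O ->
  exists D, [/\ open D, compact D, D x & D `<=` O].
Proof.
move=> xO; pose f := @to_unit_space G.
have [U [g [oU Ux ofU gc gK]]] := gsrc_chart x.
have nfU : nbhs (f x) (f @` U) by apply: open_nbhs_nbhs; split => //; exists x.
have nO : nbhs (f x) (f @` U `&` g @^-1` O).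
  have nO : nbhs (g (f x)) O by rewrite gK.
  have /subspace_continuousP/(_ (f x) (nbhs_singleton nfU) O nO) := gc.
  rewrite nbhs_simpl /within /= => h.
  by apply: filterS2 nfU h => v fUv h; split => //; exact: h.
have [C [oC cC Cx CO]] := compact_open_basis (@unit_space_hausdorff G)
  (@unit_space_locally_compact G) (@unit_space_totally_disconnected G) nO.
exists (g @` C); split.
- rewrite (_ : g @` C = U `&` f @^-1` C).
    by apply: openI => //; apply: open_comp => // y _;
      exact: to_unit_space_continuous.
  apply/seteqP; split=> [_ [v Cv <-]|y [Uy Cy]].
    by have [[z Uz zv] _] := CO _ Cv; rewrite /= -zv gK// zv.
  by exists (f y) => //; exact: gK.
- apply: continuous_compact cC; apply: continuous_subspaceW gc => v /CO[].
  by [].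
- by exists (f x) => //; exact: gK.
- by move=> _ [v Cv <-]; have [_] := CO _ Cv.
Qed.

Lemma near_gsrc_inj x : \forall y \near x, gsrc y = gsrc x -> y = x.
Proof.
have [U [g [oU Ux _ _ gK]]] := gsrc_chart x.
apply: (filterS _ (open_nbhs_nbhs (conj oU Ux))) => y Uy /to_unit_spaceE yx.
by rewrite -(gK y Uy) yx gK.
Qed.

Lemma near_grng_inj x : \forall y \near x, grng y = grng x -> y = x.
Proof.
have := @ginv_continuous G x _ (near_gsrc_inj (ginv x)); rewrite nbhs_simpl /=.
apply: filterS => y h yx; have {}h : ginv y = ginv x.
  by apply: h; rewrite !gsrcV.
by rewrite -(ginvK y) h ginvK.
Qed.

(** Close to a unit, [y] and its source lie in one chart and have the same source, so they
    coincide. *)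
Lemma open_unit_space : open (unit_space G).
Proof.
rewrite openE => u Gu; have su := unit_src Gu.
have [U [g [oU Uu _ _ gK]]] := gsrc_chart u.
have nU : nbhs u U by exact: open_nbhs_nbhs.
have nsU : nbhs (gsrc u) U by rewrite su.
apply: filterS2 nU (@gsrc_continuous G u _ nsU) => y Uy /= Usy.
exists y => //; rewrite -[RHS](gK y Uy) -[LHS](gK _ Usy).
by congr g; apply/to_unit_spaceE; exact: gsrc_src.
Qed.

End AmpleTopology.

(** * Ideals of a nonunital ring *)

Section NonUnitalIdeals.
Context {A : nonUnitalRingType}.
Implicit Types (a b c : A) (I J K : set A).

Lemma nmul0l a : nmul 0 a = 0.
Proof. by apply: (addrI (nmul 0 a)); rewrite -nmulDl !addr0. Qed.

Lemma nmul0r a : nmul a 0 = 0.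
Proof. by apply: (addrI (nmul a 0)); rewrite -nmulDr !addr0. Qed.

Lemma nmulNl a b : nmul (- a) b = - nmul a b.
Proof. by apply: (addrI (nmul a b)); rewrite -nmulDl !subrr nmul0l. Qed.

Lemma nmulBl a b c : nmul (a - b) c = nmul a c - nmul b c.
Proof. by rewrite nmulDl nmulNl. Qed.

Lemma nmul_suml (T : Type) (r : seq T) (F : T -> A) b :
  nmul (\sum_(i <- r) F i) b = \sum_(i <- r) nmul (F i) b.
Proof.
by apply: (big_morph (nmul^~ b)) => [x y|]; [exact: nmulDl|exact: nmul0l].
Qed.

Lemma nmul_sumr (T : Type) (r : seq T) (F : T -> A) b :
  nmul b (\sum_(i <- r) F i) = \sum_(i <- r) nmul b (F i).
Proof.
by apply: (big_morph (nmul b)) => [x y|]; [exact: nmulDr|exact: nmul0r].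
Qed.

Lemma idealN I a : two_sided_ideal I -> I a -> I (- a).
Proof. by move=> [I0 IB _] Ia; rewrite -sub0r; exact: IB. Qed.

Lemma idealD I a b : two_sided_ideal I -> I a -> I b -> I (a + b).
Proof.
move=> Ii Ia Ib; rewrite -[b]opprK.
by have [_ + _] := Ii; apply => //; exact: idealN.
Qed.

Lemma ideal_sum (T : Type) I (r : seq T) (P : pred T) (F : T -> A) :
  two_sided_ideal I -> (forall i, P i -> I (F i)) ->
  I (\sum_(i <- r | P i) F i).
Proof.
move=> Ii IF; apply: big_ind => //; first by case: Ii.
by move=> x y; exact: idealD.
Qed.

Lemma two_sided_idealI I J :
  two_sided_ideal I -> two_sided_ideal J -> two_sided_ideal (I `&` J).
Proof.
move=> [I0 IB IM] [J0 JB JM]; split => //.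
  by move=> x y [Ix Jx] [Iy Jy]; split; [exact: IB|exact: JB].
by move=> a x [/(IM a)[Il Ir] /(JM a)[Jl Jr]].
Qed.

Lemma two_sided_ideal_add I J :
  two_sided_ideal I -> two_sided_ideal J -> two_sided_ideal (ideal_add I J).
Proof.
move=> [I0 IB IM] [J0 JB JM]; split.
- by exists 0 => //; exists 0 => //; rewrite addr0.
- move=> _ _ [x Ix [y Jy <-]] [x' Ix' [y' Jy' <-]].
  exists (x - x'); first exact: IB.
  by exists (y - y'); [exact: JB|rewrite opprD addrACA].
move=> a _ [x Ix [y Jy <-]]; rewrite nmulDl nmulDr.
have [Il Ir] := IM a _ Ix; have [Jl Jr] := JM a _ Jy.
split; first by exists (nmul a x) => //; exists (nmul a y).
by exists (nmul x a) => //; exists (nmul y a).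
Qed.

Lemma mem_ideal_mul I J a b : I a -> J b -> ideal_mul I J (nmul a b).
Proof.
by move=> Ia Jb; exists 1%N, (fun=> a), (fun=> b); split => //;
  rewrite big_ord1.
Qed.

Lemma two_sided_ideal_mul I J :
  two_sided_ideal I -> two_sided_ideal J -> two_sided_ideal (ideal_mul I J).
Proof.
move=> Ii Ji; split.
- by exists 0%N, (fun=> 0), (fun=> 0); split;
    [case: Ii|case: Ji|rewrite big_ord0].
- move=> _ _ [n [x [y [Ix Jy ->]]]] [m [x' [y' [Ix' Jy' ->]]]].
  exists (n + m)%N,
    (fun i => match fintype.split i with inl j => x j | inr j => - x' j end),
    (fun i => match fintype.split i with inl j => y j | inr j => y' j end).
  split.
  + by move=> i; case: fintype.split => j //; exact: idealN.
  + by move=> i; case: fintype.split.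
  rewrite big_split_ord /= -sumrN; congr (_ + _); apply: eq_bigr => i _.
    by rewrite (unsplitK (inl i)).
  by rewrite (unsplitK (inr i)) nmulNl.
move=> a _ [n [x [y [Ix Jy ->]]]]; rewrite nmul_suml nmul_sumr; split.
- exists n, (fun i => nmul a (x i)), y; split => //.
    by move=> i; have [_ _ /(_ a _ (Ix i))[]] := Ii.
  by apply: eq_bigr => i _; exact: nmulA.
- exists n, x, (fun i => nmul (y i) a); split => //.
    by move=> i; have [_ _ /(_ a _ (Jy i))[]] := Ji.
  by apply: eq_bigr => i _; rewrite nmulA.
Qed.

End NonUnitalIdeals.

(** * Elements of the Steinberg algebra with prescribed values on finitely many fibres *)

Section SteinbergElements.
Context {R : comPzRingType} {G : hausdorffAmpleGroupoidType}.
Local Notation A := (steinberg R G).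
Implicit Types (x y z u v : G) (f g k e : A) (D F : set G) (phi psi : G -> R).

Lemma steinbergD f g y : (f + g) y = f y + g y. Proof. by []. Qed.

Lemma steinbergB f g y : (f - g) y = f y - g y. Proof. by []. Qed.

Lemma steinberg_sum (T : Type) (r : seq T) (f_ : T -> A) y :
  (\sum_(i <- r) f_ i) y = \sum_(i <- r) f_ i y.
Proof. by apply: (big_morph (fun f : A => f y)). Qed.

Lemma steinberg_mulE f g : nmul f g = convolution f g :> (G -> R).
Proof. by []. Qed.

(** In a Hausdorff space the compact set [D] is closed, so the function is also constant near the
    points outside [D]. *)
Lemma indicator_steinberg D (r : R) : open D -> compact D ->
  (fun x => if x \in D then r else 0) \in @steinberg_pred R G.
Proof.
move=> oD cD; have Dc := compact_closed (@groupoid_hausdorff G) cD.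
rewrite inE; set f := (fun x => _).
have fl : locally_constant f.
  move=> x; have [xD|xD] := boolP (x \in D).
    have : nbhs x D by apply: open_nbhs_nbhs; split => //; exact: set_mem.
    by apply: filterS => y yD; rewrite /f xD mem_set.
  have : nbhs x (~` D).
    apply: open_nbhs_nbhs; split; first exact: closed_openC.
    by move=> Dx; move: xD; rewrite mem_set.
  by apply: filterS => y yD; rewrite /f (negPf xD) memNset.
split => //; apply: (subclosed_compact (locally_constant_closed fl) cD).
by move=> x /=; rewrite /f; case: ifPn => [/set_mem//|]; rewrite eqxx.
Qed.

(** The neighbourhood [D] of [x] is so small that a point of [D] with source (or range) in [F]
    shares it with [x]; local injectivity of source and range then forces that point to be [x]. *)
Lemma exists_bump F x (r : R) : finite_set F ->
  exists f, forall y, F (gsrc y) \/ F (grng y) -> f y = if y == x then r else 0.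
Proof.
move=> fF.
have near_map (h : G -> G) : continuous h ->
    \forall y \near x, forall v, F v -> h y = v -> h x = v.
  move=> hc; apply: (near_finite fF) => v Fv.
  have [->|hxv] := pselect (h x = v); first exact: nearW.
  by apply: filterS (@neq_near G G h (cst v) x _ _ (hc x) (cvg_cst _) hxv).
have [D [oD cD Dx DO]] := ample_compact_open_basis (filterI
  (filterI (near_map _ (@gsrc_continuous G)) (near_map _ (@grng_continuous G)))
  (filterI (near_gsrc_inj x) (near_grng_inj x)) : nbhs x _).
exists (Steinberg (indicator_steinberg r oD cD)) => y Fy /=.
have [->|yx] := eqVneq y x; first by rewrite mem_set.
rewrite memNset// => /DO[[/= sF rF] [/= sI rI]]; move/eqP: yx; apply.
by case: Fy => Fy; [apply: sI|apply: rI]; rewrite ?(sF _ Fy)// (rF _ Fy).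
Qed.

(** The sum of the bumps at the points of the support of [phi]. Such lifts let finitely supported
    functions, which are rarely locally constant, act on ideals. *)
Lemma steinberg_lift F phi : finite_set F -> finite_set [set x | phi x != 0] ->
  exists f, forall y, F (gsrc y) \/ F (grng y) -> f y = phi y.
Proof.
move=> fF fphi.
have [b bP] := choice (fun x => exists_bump x (phi x) fF).
exists (\sum_(x <- fset_set [set x | phi x != 0]) b x) => y Fy.
rewrite steinberg_sum.
under eq_bigr do rewrite bP//.
have [phiy|phiy] := eqVneq (phi y) 0.
  rewrite big1 // => x _.
  by case: eqP => // <-.
rewrite (bigD1_seq y) /=; [|by rewrite in_fset_set// inE|exact: fset_uniq].
by rewrite eqxx big1 ?addr0// => x; rewrite eq_sym => /negPf ->.
Qed.

Lemma ginv_src x : ginv (gsrc x) = gsrc x.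
Proof. by rewrite {1}/gsrc ginvM ?gsrcV// ginvK. Qed.

(** Only the unit [gsrc y] contributes to the sum: right multiplication by the indicator restricts
    to the fibres over [D]. *)
Lemma convolution_unit_indicator D phi (r : R) y : D `<=` unit_space G ->
  convolution phi (fun x => if x \in D then r else 0) y =
  if gsrc y \in D then phi y * r else 0.
Proof.
move=> DU; rewrite (@convolution_widen _ _ [set gsrc y]).
- by rewrite fsbig_set1 ginv_src gsrcK; case: ifP => // _; rewrite mulr0.
- by move=> _ ->; exact: gsrc_src.
- move=> z zy; case: ifPn => [/set_mem/DU/unit_src <- _|]; first exact: zy.
  by rewrite eqxx.
Qed.

End SteinbergElements.

(** * Ideals seen on a single fibre of the source map *)

Section FiberIdeals.
Context {R : comPzRingType} {G : hausdorffAmpleGroupoidType}.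
Local Notation A := (steinberg R G).
Implicit Types (x y z u v : G) (f g k e : A) (I J : set A) (phi psi : G -> R).

Lemma near_gsrc_avoid (K : set G) u : compact K ->
  (forall y, K y -> gsrc y <> u) ->
  \forall v \near u, forall y, K y -> gsrc y <> v.
Proof.
move=> /compact_near_coveringP Kc Ku.
apply: (Kc _ (nbhs u) (fun v y => gsrc y <> v)) => y /Ku yu.
apply: filterS
  (@neq_near G _ (fun q : G * G => gsrc q.1) snd (y, u) _ _ _ _ yu) => //.
  by apply: (@cvg_comp _ _ _ fst gsrc); [exact: cvg_fst|exact: gsrc_continuous].
exact: cvg_snd.
Qed.

(** The sources of the compact support of [f] avoid a neighbourhood of [u]; [e] is the indicator of
    a compact open set of units inside it. *)
Lemma exists_local_annihilator f u : unit_space G u ->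
  (forall y, gsrc y = u -> f y = 0) ->
  exists (e : A) (D : set G), [/\ open D, D u, nmul f e = 0 &
    forall k y, (nmul k e : A) y = if gsrc y \in D then k y else 0].
Proof.
move=> Gu fu0; have /set_mem [_ fc] := steinbergP f.
have nf : \forall v \near u, forall y, f y != 0 -> gsrc y <> v.
  by apply: near_gsrc_avoid fc _ => y /= /eqP fy /fu0.
have nU : nbhs u (unit_space G).
  by apply: open_nbhs_nbhs; split => //; exact: open_unit_space.
have [D [oD cD Du DO]] := ample_compact_open_basis (filterI nf nU : nbhs u _).
have DU : D `<=` unit_space G by move=> y /DO[].
pose e : A := Steinberg (indicator_steinberg (1 : R) oD cD).
have eP k y : (nmul k e : A) y = if gsrc y \in D then k y else 0.
  by rewrite steinberg_mulE/= convolution_unit_indicator// mulr1.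
exists e, D; split => //.
apply/val_inj/funext => y; apply: etrans (eP f y) _;
  case: ifP => // /set_mem /DO[h _].
by have [//|/h] := eqVneq (f y) 0.
Qed.

(** Here [phi] is any function on [G], so that point masses, translates and extensions by zero are
    allowed; only its values on the fibre over [u] matter. *)
Definition fiber_mem I u phi :=
  exists2 f, I f & forall y, gsrc y = u -> f y = phi y.

(** Near each unit [f] agrees with an element of [I], so cutting [f] down to the fibres over a small
    [D] lands in [I]. Finitely many such [D] cover the sources of the support, and [f] is assembled
    from them. *)
Lemma ideal_local I f : two_sided_ideal I ->
  (forall u, unit_space G u -> fiber_mem I u f) -> I f.
Proof.
move=> Ii If; have [I0 IB IM] := Ii.
have loc u : exists De : set G * A, [/\ open De.1, unit_space G u -> De.1 u,
    forall k y, (nmul k De.2 : A) y = if gsrc y \in De.1 then k y else 0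
    & I (nmul f De.2)].
  have [Gu|nGu] := pselect (unit_space G u); last first.
    (* Default values where [u] is not a unit, so that the choice below ranges over all of [G]. *)
    exists (set0, 0); rewrite [_.1]/= [_.2]/=; split => //; first exact: open0.
      by move=> k y; rewrite (nmul0r k) in_set0.
    by rewrite (nmul0r f).
  have [g Ig gf] := If u Gu.
  have [y yu|e [D [oD Du fge eP]]] := @exists_local_annihilator (f - g) u Gu.
    by rewrite steinbergB gf// subrr.
  exists (D, e); split => //=.
  move: fge; rewrite nmulBl => /eqP; rewrite subr_eq0 => /eqP ->.
  by have [] := IM e g Ig.
have [De DeP] := choice loc.
suff key (s : seq G) k : (forall u, I (nmul k (De u).2)) ->
    (forall y, k y != 0 -> exists2 u, u \in s & (De u).1 (gsrc y)) -> I k.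
  have /set_mem [_ /compact_near_coveringP fc] := steinbergP f.
  (* Along [F] a set outgrows every finite set, so near-covering compactness yields a finite
     subcover. *)
  pose F := filter_from [set B : set G | finite_set B]
    (fun B => [set C : set G | B `<=` C]).
  have FF : Filter F.
    apply: filter_from_filter; first by exists set0; exact: finite_set0.
    move=> B C fB fC; exists (B `|` C); first by rewrite /= finite_setU.
    by move=> E; rewrite /= subUset.
  have [B fB BP] : \forall C \near F, [set y | f y != 0] `<=`
      (fun y => exists2 u, C u & (De u).1 (gsrc y)).
    apply: (fc _ _ (fun C y => exists2 u, C u & (De u).1 (gsrc y)) FF) => y _.
    have [oD Du _ _] := DeP (gsrc y).
    exists (gsrc @^-1` (De (gsrc y)).1, [set C | [set gsrc y] `<=` C]).
      split => /=; last by exists [set gsrc y] => //; exact: finite_set1.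
      apply: (@gsrc_continuous G); apply: open_nbhs_nbhs; split => //.
      by apply: Du; exists y.
    by move=> [z C] /= [Dz Cy]; exists (gsrc y) => //; exact: Cy.
  have [s Bs] := (iffLR (finite_seqP _)) fB.
  apply: (key s f) => [u|y fy]; first by have [] := DeP u.
  by have [u Bu Du] := BP B (@subset_refl _ _) y fy; exists u => //;
    rewrite Bs in Bu.
elim: s k => [|u s IH] k Ik ks.
  rewrite (_ : k = 0)//; apply/val_inj/funext => y /=.
  by apply/eqP/negPn/negP => /ks[].
have [_ _ uP _] := DeP u.
(* The difference of [k] and its cut over [u] vanishes on the fibres over [(De u).1], so the
   remaining units [s] cover it. *)
rewrite -(subrK (nmul k (De u).2) k); apply: idealD => //; apply: IH.
  move=> v; rewrite nmulBl; apply: IB => //.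
  by have [] := IM (De v).2 _ (Ik u).
move=> y; rewrite steinbergB uP; case: ifPn => [_|yu];
  first by rewrite subrr eqxx.
rewrite subr0 => /ks[v]; rewrite inE => /orP[/eqP -> Dy|vs Dy];
  last by exists v.
by move: yu; rewrite mem_set.
Qed.

Lemma fiber_mem_self I u f : I f -> fiber_mem I u f.
Proof. by exists f. Qed.

Lemma eq_fiber_mem I u phi psi : (forall y, gsrc y = u -> phi y = psi y) ->
  fiber_mem I u phi -> fiber_mem I u psi.
Proof. by move=> e [f If fphi]; exists f => // y yu; rewrite fphi// e. Qed.

Lemma fiber_memS I J u phi : I `<=` J -> fiber_mem I u phi -> fiber_mem J u phi.
Proof. by move=> IJ [f /IJ Jf fphi]; exists f. Qed.

Lemma fiber_memD I u phi psi : two_sided_ideal I ->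
  fiber_mem I u phi -> fiber_mem I u psi -> fiber_mem I u (phi + psi).
Proof.
move=> Ii [f If fphi] [g Ig gpsi]; exists (f + g); first exact: idealD.
by move=> y yu; rewrite steinbergD fphi// gpsi.
Qed.

Lemma fiber_memB I u phi psi : two_sided_ideal I ->
  fiber_mem I u phi -> fiber_mem I u psi -> fiber_mem I u (phi - psi).
Proof.
move=> [_ IB _] [f If fphi] [g Ig gpsi]; exists (f - g); first exact: IB.
by move=> y yu; rewrite steinbergB fphi// gpsi.
Qed.

(** The two witnesses [f] and [g] may differ, but they agree near the fibre: with [e] the indicator
    of a small neighbourhood of [u], [f e = g e] lies in both ideals. *)
Lemma fiber_memI I J u phi : two_sided_ideal I -> two_sided_ideal J ->
  unit_space G u -> fiber_mem I u phi -> fiber_mem J u phi ->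
  fiber_mem (I `&` J) u phi.
Proof.
move=> [_ _ IM] [_ _ JM] Gu [f If fphi] [g Jg gphi].
have [y yu|e [D [_ Du fge eP]]] := @exists_local_annihilator (f - g) u Gu.
  by rewrite steinbergB fphi// gphi// subrr.
exists (nmul f e); last by move=> y yu; rewrite eP yu mem_set// fphi.
split; first by have [] := IM e f If.
move: fge; rewrite nmulBl => /eqP; rewrite subr_eq0 => /eqP ->.
by have [] := JM e g Jg.
Qed.

(** On the fibre over [u] the product evaluates [psi] only at elements whose source is the range of
    a point of the support of [k]. These sources are finite in number, so a lift of [psi] that is
    right over them suffices; it depends on [k]. *)
Lemma exists_mull psi k u : finite_set [set x | psi x != 0] ->
  exists e, forall y, gsrc y = u -> (nmul e k : A) y = convolution psi k y.
Proof.
move=> fpsi.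
have fF : finite_set (grng @` [set z | gsrc z = u /\ k z != 0]).
  by apply: finite_image; exact: (steinberg_row_finite (steinbergP k)).
have [e eP] := steinberg_lift fF fpsi.
exists e => y yu; rewrite steinberg_mulE; apply: eq_fsbigr => z /set_mem /= zy.
have [->|kz] := eqVneq (k z) 0; first by rewrite !mulr0.
rewrite eP//; left; exists z; first by split => //; rewrite zy.
by rewrite gsrcM ?gsrcV// grngV.
Qed.

Lemma exists_mulr psi u : finite_set [set x | psi x != 0] ->
  exists e, forall k y, gsrc y = u -> (nmul k e : A) y = convolution k psi y.
Proof.
move=> fpsi; have [e eP] := steinberg_lift (finite_set1 u) fpsi.
exists e => k y yu; rewrite steinberg_mulE;
  apply: eq_fsbigr => z /set_mem /= zy.
by rewrite eP//; left; rewrite zy yu.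
Qed.

Lemma fiber_mem_mull I u phi psi : two_sided_ideal I ->
  finite_set [set x | psi x != 0] ->
  fiber_mem I u phi -> fiber_mem I u (convolution psi phi).
Proof.
move=> [_ _ IM] fpsi [f If fphi]; have [e eP] := exists_mull f u fpsi.
exists (nmul e f); first by have [] := IM e f If.
move=> y yu; rewrite eP//; apply: eq_fsbigr => z /set_mem /= zy.
by rewrite fphi// zy.
Qed.

(** The sum evaluates [phi] at [y z^-1], whose source is the range [v] of [z]: right multiplication
    carries the fibre over [v] to that over [u]. *)
Lemma fiber_mem_mulr I u v phi psi : two_sided_ideal I ->
  finite_set [set x | psi x != 0] ->
  (forall z, gsrc z = u -> psi z != 0 -> grng z = v) ->
  fiber_mem I v phi -> fiber_mem I u (convolution phi psi).
Proof.
move=> [_ _ IM] fpsi psiv [f If fphi]; have [e eP] := exists_mulr u fpsi.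
exists (nmul f e); first by have [] := IM e f If.
move=> y yu; rewrite eP//; apply: eq_fsbigr => z /set_mem /= zy.
have [->|psiz] := eqVneq (psi z) 0; first by rewrite !mulr0.
rewrite fphi// gsrcM ?gsrcV// ?grngV//; apply: psiv => //; by rewrite zy.
Qed.

Definition delta x : G -> R := fun y => if y == x then 1 else 0.

Lemma finite_delta x : finite_set [set y | delta x y != 0].
Proof.
apply: sub_finite_set (finite_set1 x) => y /=; rewrite /delta.
by case: (y =P x) => // _; rewrite eqxx.
Qed.

Lemma convolution_deltal x phi y : convolution (delta x) phi y =
  if grng y == grng x then phi (gmul (ginv x) y) else 0.
Proof.
rewrite /convolution; case: eqP => [yx|yx].
  rewrite -(@fsbig_widen _ _ _ _ [set gmul (ginv x) y]).
  - rewrite fsbig_set1 ginvM ?gsrcV// ginvK -gmulgA ?grngV ?gsrcV//.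
    by rewrite /delta -/(grng y) yx grngK eqxx mul1r.
  - by move=> _ ->; rewrite /= gsrcM// gsrcV.
  move=> z [/= zy zx]; rewrite /delta; case: eqP => [e|]; last by rewrite mul0r.
  case: zx; rewrite -e ginvM ?grngV// ginvK gmulgA ?grngV ?gsrcV//.
  by rewrite -/(gsrc y) -zy gsrcK.
rewrite fsbig1// => z /= zy; rewrite /delta; case: eqP => [e|];
  last by rewrite mul0r.
by case: yx; rewrite -e grngM// grngV.
Qed.

Lemma convolution_deltar x phi y : gsrc y = gsrc x ->
  convolution phi (delta x) y = phi (gmul y (ginv x)).
Proof.
move=> yx; rewrite (@convolution_widen _ _ [set x]).
- by rewrite fsbig_set1 /delta eqxx mulr1.
- by move=> _ ->.
by move=> z _; rewrite /delta; case: (z =P x) => // _; rewrite eqxx.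
Qed.

Lemma fiber_mem_translatel I u phi x : two_sided_ideal I -> fiber_mem I u phi ->
  fiber_mem I u (fun y =>
    if grng y == grng x then phi (gmul (ginv x) y) else 0).
Proof.
move=> Ii /(fiber_mem_mull Ii (finite_delta x)); apply: eq_fiber_mem => y _.
exact: convolution_deltal.
Qed.

Lemma fiber_mem_translater I phi x : two_sided_ideal I ->
  fiber_mem I (grng x) phi ->
  fiber_mem I (gsrc x) (fun y => phi (gmul y (ginv x))).
Proof.
move=> Ii /(@fiber_mem_mulr I (gsrc x) _ _ (delta x) Ii (finite_delta x)) h.
apply: eq_fiber_mem (h _) => [y|z _]; first exact: convolution_deltar.
by rewrite /delta; case: (z =P x) => [->//|_]; rewrite eqxx.
Qed.

(** On the fibre over [u], [k] is the finite sum of its pieces of constant range, and each piece is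
    a left multiple of [k]. *)
Lemma range_induction u k (S : set A) : S 0 ->
  (forall f g, S f -> S g -> S (f + g)) ->
  (forall f g, (forall y, gsrc y = u -> f y = g y) -> S f -> S g) ->
  (forall e b, gsrc b = u -> k b != 0 ->
    (forall y, gsrc y = u ->
      (nmul e k : A) y = if grng y == grng b then k y else 0) ->
    S (nmul e k)) ->
  S k.
Proof.
move=> S0 SD Seq Se.
pose V := grng @` [set z | gsrc z = u /\ k z != 0].
have fV : finite_set V.
  by apply: finite_image; exact: (steinberg_row_finite (steinbergP k)).
(* Left convolution with the point mass at a unit [v] keeps the values of [k] at range [v] and kills
   the others. *)
have /choice [e eP] v : exists e, forall y, gsrc y = u ->
    (nmul e k : A) y = convolution (delta v) k y.
  exact: exists_mull (finite_delta v).
have {}eP v y : V v -> gsrc y = u ->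
    (nmul (e v) k : A) y = if grng y == v then k y else 0.
  move=> [z _ <-] yu; rewrite eP// convolution_deltal.
  have -> : grng (grng z) = grng z by rewrite -(gsrcV z) grng_src.
  case: eqP => // yz; rewrite -(gsrcV z) ginv_src gsrcV -yz.
  by rewrite grngK.
apply: (Seq (\sum_(v <- fset_set V) nmul (e v) k)).
  move=> y yu; rewrite steinberg_sum.
  have [ky|ky] := eqVneq (k y) 0.
    rewrite ky big1_seq// => v; rewrite in_fset_set// => /andP[_ /set_mem Vv].
    by rewrite eP//; case: ifP.
  have Vy : V (grng y) by exists y.
  rewrite (bigD1_seq (grng y)) ?fset_uniq ?in_fset_set ?mem_set// eP// eqxx.
  rewrite big1_seq => [|v]; first exact: (addr0 (k y)).
  rewrite in_fset_set// eq_sym => /andP[vy /set_mem Vv].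
  by rewrite eP// (negPf vy).
rewrite big_seq; apply: big_ind => // v; rewrite in_fset_set// => /set_mem Vv.
have [b [bu kb] bv] := Vv; apply: Se bu kb _ => y yu.
by rewrite eP// bv.
Qed.

End FiberIdeals.

(** * Induced ideals in the group algebras of the isotropy groups *)

Section IsotropyRestriction.
Context {R : comPzRingType} {G : hausdorffAmpleGroupoidType} (u : unit_space G).
Local Notation H := (isotropy u).
Local Notation A := (steinberg R G).
Local Notation RH := (group_algebra R H).
Implicit Types (a b : RH) (I J : set A) (x y : G).

Definition isotropy_extend a : G -> R := fun y =>
  if pselect (gsrc y = val u /\ grng y = val u) is left h then a (isotropy_mk h)
  else 0.

Lemma isotropy_extend_val a (x : H) : isotropy_extend a (val x) = a x.
Proof.
rewrite /isotropy_extend; case: pselect => [h|[]]; last first.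
  by split; [exact: isotropy_src|exact: isotropy_rng].
by congr (a _); exact: val_inj.
Qed.

Lemma isotropy_extend_out a y : ~ (gsrc y = val u /\ grng y = val u) ->
  isotropy_extend a y = 0.
Proof. by rewrite /isotropy_extend; case: pselect. Qed.

Lemma isotropy_extend_neq0 a y : isotropy_extend a y != 0 ->
  gsrc y = val u /\ grng y = val u.
Proof.
by move=> ay; apply: contrapT => h; move: ay;
  rewrite isotropy_extend_out// eqxx.
Qed.

Lemma isotropy_extendD a b y :
  isotropy_extend (a + b) y = isotropy_extend a y + isotropy_extend b y.
Proof. by rewrite /isotropy_extend; case: pselect => // _; rewrite addr0. Qed.

Lemma isotropy_extendB a b y :
  isotropy_extend (a - b) y = isotropy_extend a y - isotropy_extend b y.
Proof. by rewrite /isotropy_extend; case: pselect => // _; rewrite subr0. Qed.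

Lemma finite_isotropy_extend a : finite_set [set y | isotropy_extend a y != 0].
Proof.
have /set_mem fa := group_algebraP a.
apply: sub_finite_set (finite_image (val : H -> G) fa) => y /= ay.
have h := isotropy_extend_neq0 ay; exists (isotropy_mk h) => //=.
by rewrite -isotropy_extend_val.
Qed.

(** A nonzero term has both [z] and [y z^-1] in the isotropy group, hence also [y]; the sum then
    runs over the group. *)
Lemma isotropy_extendM a b y : gsrc y = val u ->
  isotropy_extend (nmul a b) y =
  convolution (isotropy_extend a) (isotropy_extend b) y.
Proof.
move=> yu; have [h|nh] := pselect (gsrc y = val u /\ grng y = val u);
  last first.
  rewrite isotropy_extend_out// /convolution fsbig1// => z /= zy.
  have [->|bz] := eqVneq (isotropy_extend b z) 0; first by rewrite mulr0.
  have [->|az] := eqVneq (isotropy_extend a (gmul y (ginv z))) 0.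
    by rewrite mul0r.
  have [_] := isotropy_extend_neq0 az; rewrite grngM ?grngV// => ry.
  by case: nh.
rewrite -[y]/(val (isotropy_mk h)) isotropy_extend_val.
rewrite (@convolution_widen _ _ [set z | gsrc z = val u /\ grng z = val u]).
- rewrite (@reindex_fsbig _ _ _ H G val setT); last first.
    split => [x _|x x' _ _ /val_inj//|z hz].
      by split; [exact: isotropy_src|exact: isotropy_rng].
    by exists (isotropy_mk hz).
  apply: eq_fsbigr => x _; rewrite isotropy_extend_val; congr (_ * _).
  by rewrite -isotropy_extend_val.
- by move=> z /= [-> _]; rewrite yu.
- by move=> z _; exact: isotropy_extend_neq0.
Qed.

Definition isotropy_ideal I : set RH :=
  [set a | fiber_mem I (val u) (isotropy_extend a)].

Lemma two_sided_isotropy_ideal I : two_sided_ideal I ->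
  two_sided_ideal (isotropy_ideal I).
Proof.
move=> Ii; split.
- exists 0; first by case: Ii.
  by move=> y _; rewrite /isotropy_extend; case: pselect.
- move=> a b Ia Ib; apply: eq_fiber_mem (fiber_memB Ii Ia Ib) => y _.
  by rewrite isotropy_extendB.
move=> a b Ib; split.
  apply: eq_fiber_mem (fiber_mem_mull Ii (finite_isotropy_extend a) Ib) => y yu.
  by rewrite isotropy_extendM.
apply: eq_fiber_mem (fiber_mem_mulr Ii (finite_isotropy_extend a) _ Ib) =>
  [y yu|].
  by rewrite isotropy_extendM.
by move=> z _ /isotropy_extend_neq0[].
Qed.

(** Left translation by [x] is injective from the isotropy group into the fibre over [u], on which
    [f] has finite support. *)
Lemma translate_finitely_supported (f : A) x : gsrc x = val u ->
  (fun h : H => f (gmul x (val h))) \in @finitely_supported R H.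
Proof.
move=> xu; rewrite inE /=.
have xh (h : H) : gsrc x = grng (val h) by rewrite isotropy_rng.
have := steinberg_row_finite (steinbergP f) (val u).
move=> /(@finite_preimage H G _ (fun h => gmul x (val h))) fx.
apply: sub_finite_set (fx _) => [h /= fh|h h' _ _ e].
  by split => //; exact: (etrans (gsrcM (xh h)) (isotropy_src h)).
apply: val_inj.
by rewrite -(gmulKg (iffRL (composableE _ _) (xh h))) e gmulKg//;
  apply/composableE.
Qed.

End IsotropyRestriction.

(** * Distributivity of the ideal lattice *)

Section Arithmetical.
Context {R : comPzRingType} {G : hausdorffAmpleGroupoidType}.
Local Notation A := (steinberg R G).
Implicit Types (I J K L : set A) (x y b : G).

(** Translation by [b^-1] carries [f = g + h] into the isotropy group algebra at [gsrc b].
    Distributivity there splits the translate of [f]; the summands are lifted to the two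
    intersections and translated back by [b]. *)
Lemma arithmetical_fiber I J K (f g h : A) b :
  arithmetical (group_algebra R (isotropy (to_unit_space b))) ->
  two_sided_ideal I -> two_sided_ideal J -> two_sided_ideal K ->
  I f -> J g -> K h -> f = g + h ->
  (forall y, gsrc y = gsrc b -> f y != 0 -> grng y = grng b) ->
  fiber_mem (ideal_add (I `&` J) (I `&` K)) (gsrc b) f.
Proof.
set u := to_unit_space b => arith Ii Ji Ki If Jg Kh fgh fb.
have Gu : unit_space G (gsrc b) by exists b.
have IJi := two_sided_idealI Ii Ji; have IKi := two_sided_idealI Ii Ki.
have Li := two_sided_ideal_add IJi IKi; set L := ideal_add _ _ in Li *.
have bu : gsrc b = val u by [].
pose t (k : A) : group_algebra R (isotropy u) :=
  GroupAlgebra (translate_finitely_supported k bu).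
(* On this fibre the extension of [t k] is the left translate of [k] by [b^-1], so [t] sends an
   ideal into the induced one. *)
have tE (k : A) y : gsrc y = gsrc b -> isotropy_extend (t k) y =
    if grng y == grng (ginv b) then k (gmul (ginv (ginv b)) y) else 0.
  move=> yb; rewrite ginvK grngV; case: eqP => yr; last first.
    by rewrite isotropy_extend_out// => -[].
  have yH : gsrc y = val u /\ grng y = val u by [].
  by rewrite -[y]/(val (isotropy_mk yH)) isotropy_extend_val.
have tI (N : set A) k : two_sided_ideal N -> N k -> isotropy_ideal N (t k).
  move=> Ni Nk; have := fiber_mem_self (gsrc b) Nk.
  move=> /(fiber_mem_translatel (ginv b) Ni); apply: eq_fiber_mem => y yb.
  by rewrite tE.
have : ((isotropy_ideal I : set (group_algebra R (isotropy u))) `&`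
    ideal_add (isotropy_ideal J) (isotropy_ideal K)) (t f).
  split; first exact: tI.
  exists (t g); first exact: tI.
  exists (t h); first exact: tI.
  by apply/val_inj/funext => x /=; rewrite fgh.
rewrite arith; [|exact: two_sided_isotropy_ideal..].
move=> [a1 [Ia1 Ja1] [a2 [Ia2 Ka2] a12]].
have La : fiber_mem L (gsrc b) (isotropy_extend (t f)).
  have L1 : fiber_mem L (gsrc b) (isotropy_extend a1).
    apply: fiber_memS (fiber_memI Ii Ji Gu Ia1 Ja1) => k IJk.
    by exists k => //; exists 0; [case: IKi|rewrite addr0].
  have L2 : fiber_mem L (gsrc b) (isotropy_extend a2).
    apply: fiber_memS (fiber_memI Ii Ki Gu Ia2 Ka2) => k IKk.
    by exists 0; [case: IJi|exists k => //; rewrite add0r].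
  apply: eq_fiber_mem (fiber_memD Li L1 L2) => y _.
  by rewrite -a12 isotropy_extendD.
(* Translating back recovers [f], which vanishes on this fibre at ranges other than [grng b]. *)
apply: eq_fiber_mem (fiber_mem_translatel b Li La) => y yb.
case: eqP => yr; last first.
  by apply/esym/eqP/negPn/negP => /(fb y yb).
have byr : gsrc (ginv b) = grng y by rewrite gsrcV.
rewrite tE ?gsrcM// grngM// eqxx ginvK; congr (f _).
by apply: gmulVKg.
Qed.

(** One inclusion is formal. For the other, [f = g + h] is examined fibre by fibre, and a piece
    [e f] of constant range inherits the decomposition [e g + e h]. *)
Lemma arithmetical_steinberg :
  (forall u : unit_space G, arithmetical (group_algebra R (isotropy u))) ->
  arithmetical A.
Proof.
move=> arith I J K Ii Ji Ki.
have [[_ _ IM] [_ _ JM] [_ _ KM]] := And3 Ii Ji Ki.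
have IJi := two_sided_idealI Ii Ji; have IKi := two_sided_idealI Ii Ki.
have Li := two_sided_ideal_add IJi IKi.
apply/seteqP; split; last first.
  move=> _ [g [Ig Jg] [h [Ih Kh] <-]]; split; first exact: idealD.
  by exists g => //; exists h.
move=> f [If [g Jg [h Kh gh]]]; apply: ideal_local => // u Gu.
apply: (@range_induction _ _ u f (fun k =>
  fiber_mem (ideal_add (I `&` J) (I `&` K)) u k)).
- by apply: fiber_mem_self; case: Li.
- by move=> k k'; exact: fiber_memD.
- by move=> k k'; exact: eq_fiber_mem.
move=> e b bu fb ef; rewrite -bu.
apply: (@arithmetical_fiber I J K _ (nmul e g) (nmul e h)) => //.
- by have [] := IM e f If.
- by have [] := JM e g Jg.
- by have [] := KM e h Kh.
- by rewrite -nmulDr gh.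
move=> y yb; rewrite ef ?yb//; by case: (grng y =P _) => // _; rewrite eqxx.
Qed.

End Arithmetical.

(** * Commutation of ideals under abelian isotropy *)

Section CommutingIdeals.
Context {R : comPzRingType} {G : hausdorffAmpleGroupoidType}.
Local Notation A := (steinberg R G).
Implicit Types (I J K L : set A) (f g h k : A) (x y b c u v : G).

Context (isotropyC :
  forall (u : unit_space G) (x y : isotropy u), (x * y)%g = (y * x)%g).

Lemma isotropy_gmulC x y : gsrc x = grng x -> gsrc y = gsrc x ->
  grng y = gsrc x -> gmul x y = gmul y x.
Proof.
move=> xx yx yx'; pose u := to_unit_space x.
have hx : gsrc x = val u /\ grng x = val u by [].
have hy : gsrc y = val u /\ grng y = val u by [].
exact: (congr1 val (isotropyC (isotropy_mk hx) (isotropy_mk hy))).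
Qed.

Local Ltac src_rng :=
  repeat first
    [rewrite gsrcV | rewrite grngV | rewrite gsrcM | rewrite grngM];
  congruence.

Lemma commuting_fiber I J g h b c : two_sided_ideal I -> two_sided_ideal J ->
  I g -> J h -> gsrc c = grng b ->
  (forall y, gsrc y = gsrc b -> h y != 0 -> grng y = grng b) ->
  (forall y, gsrc y = grng b -> g y != 0 -> grng y = grng c) ->
  fiber_mem (ideal_mul J I) (gsrc b) (nmul g h : A).
Proof.
move=> Ii Ji Ig Jh cb hb gc.
(* On the relevant fibres [p] is [c h b^-1] and [q], introduced next, is [c^-1 g b]. *)
have [p Jp pE] : fiber_mem J (grng b) (fun y =>
    if grng y == grng c then h (gmul (gmul (ginv c) y) b) else 0).
  have := fiber_mem_self (grng (ginv b)) Jh.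
  move=> /(fiber_mem_translater Ji)/(fiber_mem_translatel c Ji).
  by rewrite gsrcV ginvK.
have [q Iq qE] : fiber_mem I (gsrc b) (fun y =>
    if grng y == grng b then g (gmul (gmul c y) (ginv b)) else 0).
  have := fiber_mem_self (grng b) Ig.
  move=> /(fiber_mem_translater Ii)/(fiber_mem_translatel (ginv c) Ii).
  by rewrite grngV ginvK cb.
exists (nmul p q) => [|y yb]; first exact: mem_ideal_mul.
rewrite !steinberg_mulE.
pose S := [set z | gsrc z = gsrc b /\ grng z = grng b].
rewrite !(@convolution_widen _ _ S).
all: try by move=> z [/= -> _].
- have [yc|yc] := eqVneq (grng y) (grng c); last first.
    rewrite !fsbig1// => z [/= zb zr]; have [hz|hz] := eqVneq (h z) 0.
    + by rewrite hz mulr0.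
    + have [->|gz] := eqVneq (g (gmul y (ginv z))) 0; first by rewrite mul0r.
      by move/eqP: yc => []; rewrite -(gc _ _ gz) ?grngM//; src_rng.
    + by rewrite pE ?grngM ?(negPf yc) ?mul0r//; src_rng.
    + by rewrite pE ?grngM ?(negPf yc) ?mul0r//; src_rng.
  pose w := gmul (ginv c) y.
  have ws : gsrc w = gsrc b by rewrite /w; src_rng.
  have wr : grng w = grng b by rewrite /w; src_rng.
  have cw : gmul c w = y by apply: gmulVKg; rewrite yc.
  (* With [w = c^-1 y], the reindexing [x |-> b x^-1 w] matches the two sums
     term by term, because [b x^-1] and [w b^-1] commute. *)
  rewrite (@reindex_fsbig _ _ _ _ _ (fun x => gmul (gmul b (ginv x)) w) S).
    clearbody w; apply: eq_fsbigr => x /set_mem [xs xr].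
    have -> : gmul y (ginv (gmul (gmul b (ginv x)) w)) =
      gmul (gmul c x) (ginv b).
      rewrite ginvM; last by src_rng.
      rewrite ginvM; last by src_rng.
      rewrite ginvK -cw gmulgA; [|src_rng..].
      rewrite gmulVKg; last by src_rng.
      by rewrite gmulgA //; src_rng.
    rewrite pE; last by src_rng.
    rewrite qE; last by src_rng.
    rewrite grngM; last by src_rng.
    rewrite grngM; last by src_rng.
    rewrite eqxx grngM; last by src_rng.
    rewrite grngM; last by src_rng.
    (* The new order of the factors is absorbed by the commutativity of [R]. *)
    rewrite eqxx mulrC; congr (_ * _).
      congr (g _); rewrite (@gmulgA _ c); [|src_rng..].
      rewrite (@gmulgA _ (gmul b (ginv x)) w); [|src_rng..].
      rewrite (@isotropy_gmulC (gmul b (ginv x))); [|src_rng..].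
      rewrite -(@gmulgA _ _ b (ginv x)); [|src_rng..].
      rewrite gmulgVK; last by src_rng.
      by rewrite -cw gmulgA //; src_rng.
    congr (h _); rewrite -(@gmulgA _ _ _ (ginv b)); [|src_rng..].
    rewrite gmulgVK; last by src_rng.
    by apply: gmulKg; apply/composableE; src_rng.
  split=> [x [xs xr]|x x' /set_mem [xs xr] /set_mem [xs' xr'] e|z [zs zr]].
  - by split; src_rng.
  (* The inverse of the reindexing is [z |-> w z^-1 b]; it also gives surjectivity below. *)
  - pose t z := gmul (gmul w (ginv z)) b.
    have tK z : gsrc z = gsrc b -> grng z = grng b ->
        t (gmul (gmul b (ginv z)) w) = z.
      move=> zs zr; rewrite /t ginvM; last by src_rng.
      rewrite gmulVKg; last by src_rng.
      rewrite ginvM; last by src_rng.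
      by rewrite ginvK gmulgVK.
    by rewrite -(tK x)// e tK.
  exists (gmul (gmul w (ginv z)) b); first by split; src_rng.
  rewrite ginvM; last by src_rng.
  rewrite gmulVKg; last by src_rng.
  rewrite ginvM; last by src_rng.
  by rewrite ginvK gmulgVK//; src_rng.
- by move=> z zs hz; split; [rewrite zs|apply: hb; rewrite ?zs].
- move=> z zs qz; split; first by rewrite zs.
  by move: qz; rewrite qE ?zs//; case: (grng z =P _) => // _; rewrite eqxx.
Qed.

Lemma nmul_fiber_eqr k f g u : (forall y, gsrc y = u -> f y = g y) ->
  forall y, gsrc y = u -> (nmul k f : A) y = (nmul k g : A) y.
Proof.
move=> fg y yu; rewrite !steinberg_mulE; apply: eq_fsbigr => z /set_mem /= zy.
by rewrite fg// zy.
Qed.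

Lemma nmul_fiber_eql k f g u v :
  (forall y, gsrc y = u -> k y != 0 -> grng y = v) ->
  (forall y, gsrc y = v -> f y = g y) ->
  forall y, gsrc y = u -> (nmul f k : A) y = (nmul g k : A) y.
Proof.
move=> kv fg y yu; rewrite !steinberg_mulE;
  apply: eq_fsbigr => z /set_mem /= zy.
have [->|kz] := eqVneq (k z) 0; first by rewrite !mulr0.
by rewrite fg// gsrcM ?gsrcV ?grngV//; apply: kv; rewrite // zy.
Qed.

(** It suffices to treat one product [g h] on one fibre. First [h] is reduced to a piece of constant
    range, then [g] on the fibre over that range. *)
Lemma ideal_mul_subC I J : two_sided_ideal I -> two_sided_ideal J ->
  ideal_mul I J `<=` ideal_mul J I.
Proof.
move=> Ii Ji _ [n [g_ [h_ [Ig Jh ->]]]].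
have Li := two_sided_ideal_mul Ji Ii; have [_ _ IM] := Ii; have [_ _ JM] := Ji.
apply: ideal_sum => // i _; move: (g_ i) (h_ i) (Ig i) (Jh i) => g h {}Ig {}Jh.
apply: ideal_local => // u Gu.
apply: (@range_induction _ _ u h (fun k =>
  fiber_mem (ideal_mul J I) u (nmul g k : A))).
- by rewrite nmul0r; apply: fiber_mem_self; case: Li.
- by move=> k k'; rewrite nmulDr; exact: fiber_memD.
- by move=> k k' kk'; apply: eq_fiber_mem; exact: nmul_fiber_eqr.
move=> e b bu hb eh; have [Jeh _] := JM e h Jh.
have {eh} ehb y : gsrc y = u -> (nmul e h : A) y != 0 -> grng y = grng b.
  by move=> yu; rewrite eh//; case: (grng y =P _) => // _; rewrite eqxx.
move: (nmul e h) Jeh ehb => {Jh hb}h Jh hb.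
(* As [h] has the single range [grng b] over [u], the product depends on [g] only through the fibre
   over [grng b]. *)
apply: (@range_induction _ _ (grng b) g
  (fun k => fiber_mem (ideal_mul J I) u (nmul k h : A))).
- by rewrite nmul0l; apply: fiber_mem_self; case: Li.
- by move=> k k'; rewrite nmulDl; exact: fiber_memD.
- by move=> k k' kk'; apply: eq_fiber_mem; exact: nmul_fiber_eql hb kk'.
move=> d c cb gc dg; rewrite -bu.
apply: (@commuting_fiber I J _ _ b c) => //.
- by have [] := IM d g Ig.
- by move=> y yb; apply: hb; rewrite yb.
move=> y yb; rewrite dg//; by case: (grng y =P _) => // _; rewrite eqxx.
Qed.

End CommutingIdeals.

Theorem corollary4p2 (G : hausdorffAmpleGroupoidType) (R : comPzRingType) :
  ((forall (u : unit_space G) (x y : isotropy u), (x * y)%g = (y * x)%g) ->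
   forall I J : set (steinberg R G),
     two_sided_ideal I -> two_sided_ideal J ->
     ideal_mul I J = ideal_mul J I) /\
  ((forall u : unit_space G, arithmetical (group_algebra R (isotropy u))) ->
   arithmetical (steinberg R G)).
Proof.
split=> [isoC I J Ii Ji|]; last exact: arithmetical_steinberg.
by apply/seteqP; split; exact: ideal_mul_subC.
Qed.
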